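(* Let $A$ be a Picard-surjective super algebra. Then the monoidal functor $$\mathrm{AUT}(A)^{\delta}\to \mathrm{End}_{\mathrm{sAlg}^{\mathrm{bi}}_k}(A)$$ that sends an object $\phi\in\mathrm{Aut}(A)$ to the $A$-$A$-bimodule $A_\phi$ and a morphism $(a,\phi)\in A_0^\times\times\mathrm{Aut}(A)$, from $\phi$ to $i(a)\circ\phi$, to the intertwiner $A_\phi\to A_{i(a)\circ\phi}$, $x\mapsto xa^{-1}$, establishes an equivalence of 2-groups $$\mathrm{AUT}(A)^{\delta}\cong \mathrm{AUT}_{\mathrm{sAlg}^{\mathrm{bi}}_k}(A)$$ between $\mathrm{AUT}(A)^\delta$ and the automorphism 2-group of $A$ as an object of the bicategory $\mathrm{sAlg}^{\mathrm{bi}}_k$.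
   Context: Let $k=\mathbb{R}$ or $k=\mathbb{C}$. A super algebra is a finite-dimensional, $\mathbb{Z}_2$-graded, unital, associative $k$-algebra. $\mathrm{Aut}(A)$ is the group of even algebra automorphisms, $A_0^\times$ the group of even invertible elements, and $i(a)\in\mathrm{Aut}(A)$ is conjugation $x\mapsto axa^{-1}$ for $a\in A_0^\times$. Bimodules are finite-dimensional and $\mathbb{Z}_2$-graded, intertwiners are even. For $\phi\in\mathrm{Aut}(A)$, $A_\phi$ is the $A$-$A$-bimodule $A$ with left action by multiplication and right action $x\triangleleft a=x\phi(a)$. $\mathrm{sAlg}^{\mathrm{bi}}_k$ is the bicategory of super algebras, bimodules (an $A$-$B$-bimodule being a 1-morphism $B\to A$) and even intertwiners, with composition the relative tensor product; $\mathrm{End}_{\mathrm{sAlg}^{\mathrm{bi}}_k}(A)$ is the monoidal category of $A$-$A$-bimodules under $\otimes_A$. $\mathrm{AUT}_{\mathrm{sAlg}^{\mathrm{bi}}_k}(A)$ is its monoidal subcategory of invertible $A$-$A$-bimodules and invertible intertwiners. A 2-group is a monoidal groupoid in which all objects are weakly invertible; an equivalence of 2-groups is a monoidal equivalence. $A$ is Picard-surjective if every invertible $A$-$A$-bimodule is isomorphic (by an even bimodule isomorphism) to $A_\phi$ for some $\phi\in\mathrm{Aut}(A)$. $\mathrm{AUT}(A)^\delta$ is the strict 2-group associated to the crossed module $i:A_0^\times\to\mathrm{Aut}(A)$ with $\mathrm{Aut}(A)$ acting on $A_0^\times$ by evaluation (forgetting smooth structures): objects are $\phi\in\mathrm{Aut}(A)$,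 morphisms are pairs $(a,\phi)\in A_0^\times\times\mathrm{Aut}(A)$ with source $\phi$ and target $i(a)\circ\phi$, composition is $(a_2,\phi_2)\circ(a_1,\phi_1)=(a_2a_1,\phi_1)$, and the monoidal product is $(\phi_2,\phi_1)\mapsto\phi_2\circ\phi_1$ on objects and $(a_2,\phi_2)\cdot(a_1,\phi_1)=(a_2\phi_2(a_1),\phi_2\circ\phi_1)$ on morphisms. The functor is monoidal via the isomorphisms $A_\psi\otimes_A A_\phi\to A_{\psi\circ\phi}$, $m\otimes b\mapsto m\psi(b)$. *)

(* Defs.v *)
From HB Require Import structures.
From mathcomp Require Import all_boot all_order all_algebra.
From mathcomp Require Import boolp reals complex.

Set Implicit Arguments.
Unset Strict Implicit.
Unset Printing Implicit Defensive.

Import GRing.Theory.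

Declare Scope cat_scope.
Delimit Scope cat_scope with cat.

(* Morphisms are compared by Leibniz equality; composition is written in the
   applicative order, [g ∘ f] being [f] followed by [g]. *)
Record category := Category {
  ob :> Type;
  mor : ob -> ob -> Type;
  idm : forall X, mor X X;
  comp : forall X Y Z, mor Y Z -> mor X Y -> mor X Z;
  comp1m : forall X Y (f : mor X Y), comp (idm Y) f = f;
  compm1 : forall X Y (f : mor X Y), comp f (idm X) = f;
  compmA : forall X Y Z W (h : mor Z W) (g : mor Y Z) (f : mor X Y),
    comp h (comp g f) = comp (comp h g) f
}.
Arguments mor {c} X Y.
Arguments idm {c} X.
Arguments comp {c X Y Z} g f.
Notation "g ∘ f" := (comp g f) (at level 40, left associativity) : cat_scope.
Open Scope cat_scope.

Definition is_iso (C : category) (X Y : C) (f : mor X Y) : Prop :=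
  exists g : mor Y X, g ∘ f = idm X /\ f ∘ g = idm Y.

Definition isomorphic (C : category) (X Y : C) : Prop :=
  exists f : mor X Y, is_iso f.

Definition is_groupoid (C : category) : Prop :=
  forall (X Y : C) (f : mor X Y), is_iso f.

Record functor (C D : category) := Functor {
  fob :> C -> D;
  fhom : forall X Y, mor X Y -> mor (fob X) (fob Y);
  fhom_id : forall X, fhom (idm X) = idm (fob X);
  fhom_comp : forall X Y Z (g : mor Y Z) (f : mor X Y),
    fhom (g ∘ f) = fhom g ∘ fhom f
}.
Arguments fhom {C D} f {X Y} h : rename.

Record moncat := MonCat {
  mcat :> category;
  tunit : mcat;
  tens : mcat -> mcat -> mcat;
  tensm : forall X X' Y Y' : mcat,
    mor X X' -> mor Y Y' -> mor (tens X Y) (tens X' Y');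
  assoc : forall X Y Z, mor (tens (tens X Y) Z) (tens X (tens Y Z));
  lunit : forall X, mor (tens tunit X) X;
  runit : forall X, mor (tens X tunit) X;
  tensm_id : forall X Y, tensm (idm X) (idm Y) = idm (tens X Y);
  tensm_comp : forall X X' X'' Y Y' Y'' (g : mor X' X'') (f : mor X X')
      (g' : mor Y' Y'') (f' : mor Y Y'),
    tensm (g ∘ f) (g' ∘ f') = tensm g g' ∘ tensm f f';
  assoc_iso : forall X Y Z, is_iso (assoc X Y Z);
  lunit_iso : forall X, is_iso (lunit X);
  runit_iso : forall X, is_iso (runit X);
  assoc_nat : forall X X' Y Y' Z Z'
      (f : mor X X') (g : mor Y Y') (h : mor Z Z'),
    assoc X' Y' Z' ∘ tensm (tensm f g) h = tensm f (tensm g h) ∘ assoc X Y Z;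
  lunit_nat : forall X X' (f : mor X X'),
    lunit X' ∘ tensm (idm tunit) f = f ∘ lunit X;
  runit_nat : forall X X' (f : mor X X'),
    runit X' ∘ tensm f (idm tunit) = f ∘ runit X;
  triangle : forall X Y,
    tensm (idm X) (lunit Y) ∘ assoc X tunit Y = tensm (runit X) (idm Y);
  pentagon : forall W X Y Z,
    assoc W X (tens Y Z) ∘ assoc (tens W X) Y Z =
    tensm (idm W) (assoc X Y Z) ∘ assoc W (tens X Y) Z
      ∘ tensm (assoc W X Y) (idm Z)
}.
Arguments tunit {m}.
Arguments tens {m} X Y.
Arguments tensm {m X X' Y Y'} f g.
Arguments assoc {m} X Y Z.
Arguments lunit {m} X.
Arguments runit {m} X.
Notation "X ⊗ Y" := (tens X Y)
  (at level 39, left associativity) : cat_scope.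
Notation "f ⊗m g" := (tensm f g)
  (at level 39, left associativity) : cat_scope.

Definition weakly_invertible (C : moncat) (X : C) : Prop :=
  exists Y : C, isomorphic (X ⊗ Y) tunit /\ isomorphic (Y ⊗ X) tunit.

Definition is_2group (C : moncat) : Prop :=
  is_groupoid C /\ forall X : C, weakly_invertible X.

(* Monoidal functors are strong. *)
Record monfun (C D : moncat) := MonFun {
  mfun :> functor C D;
  munit : mor tunit (mfun tunit);
  mmul : forall X Y, mor (mfun X ⊗ mfun Y) (mfun (X ⊗ Y));
  munit_iso : is_iso munit;
  mmul_iso : forall X Y, is_iso (mmul X Y);
  mmul_nat : forall X X' Y Y' (f : mor X X') (g : mor Y Y'),
    mmul X' Y' ∘ (fhom mfun f ⊗m fhom mfun g)
      = fhom mfun (f ⊗m g) ∘ mmul X Y;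
  mmul_assoc : forall X Y Z,
    fhom mfun (assoc X Y Z) ∘ mmul (X ⊗ Y) Z ∘ (mmul X Y ⊗m idm (mfun Z))
      = mmul X (Y ⊗ Z) ∘ (idm (mfun X) ⊗m mmul Y Z)
          ∘ assoc (mfun X) (mfun Y) (mfun Z);
  mmul_lunit : forall X,
    fhom mfun (lunit X) ∘ mmul tunit X ∘ (munit ⊗m idm (mfun X))
      = lunit (mfun X);
  mmul_runit : forall X,
    fhom mfun (runit X) ∘ mmul X tunit ∘ (idm (mfun X) ⊗m munit)
      = runit (mfun X)
}.
Arguments munit {C D} m.
Arguments mmul {C D} m X Y.

Record is_monoidal_natiso (C D : moncat) (F G : monfun C D)
    (t : forall X, mor (F X) (G X)) : Prop := {
  mni_iso : forall X, is_iso (t X);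
  mni_nat : forall X Y (f : mor X Y), t Y ∘ fhom F f = fhom G f ∘ t X;
  mni_unit : t tunit ∘ munit F = munit G;
  mni_mul : forall X Y, t (X ⊗ Y) ∘ mmul F X Y = mmul G X Y ∘ (t X ⊗m t Y)
}.

Definition monoidally_isomorphic (C D : moncat) (F G : monfun C D) : Prop :=
  exists t : forall X, mor (F X) (G X), is_monoidal_natiso t.

Section IsoTheory.
Variable C : category.

Lemma iso_id (X : C) : is_iso (idm X).
Proof. by exists (idm X); rewrite comp1m. Qed.

Lemma iso_comp (X Y Z : C) (g : mor Y Z) (f : mor X Y) :
  is_iso g -> is_iso f -> is_iso (g ∘ f).
Proof.
move=> [g' [g'g gg']] [f' [f'f ff']]; exists (f' ∘ g'); split.
  by rewrite compmA -(compmA f') g'g compm1.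
by rewrite compmA -(compmA g) ff' compm1.
Qed.

Lemma isomorphic_refl (X : C) : isomorphic X X.
Proof. by exists (idm X); apply: iso_id. Qed.

Lemma isomorphic_sym (X Y : C) : isomorphic X Y -> isomorphic Y X.
Proof. by move=> [f [g [gf fg]]]; exists g; exists f. Qed.

Lemma isomorphic_trans (X Y Z : C) :
  isomorphic X Y -> isomorphic Y Z -> isomorphic X Z.
Proof. by move=> [f ?] [g ?]; exists (g ∘ f); apply: iso_comp. Qed.

End IsoTheory.

Lemma fhom_iso (C D : category) (F : functor C D) (X Y : C) (f : mor X Y) :
  is_iso f -> is_iso (fhom F f).
Proof.
by move=> [g [gf fg]]; exists (fhom F g); rewrite -!fhom_comp gf fg !fhom_id.
Qed.

Section MonTheory.
Variable C : moncat.

Lemma iso_tensm (X X' Y Y' : C) (f : mor X X') (g : mor Y Y') :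
  is_iso f -> is_iso g -> is_iso (f ⊗m g).
Proof.
move=> [f' [f'f ff']] [g' [g'g gg']]; exists (f' ⊗m g').
by rewrite -!tensm_comp f'f ff' g'g gg' !tensm_id.
Qed.

Lemma tensm_compl (W X Y Z : C) (g : mor Y Z) (f : mor X Y) :
  idm W ⊗m (g ∘ f) = (idm W ⊗m g) ∘ (idm W ⊗m f).
Proof. by rewrite -tensm_comp comp1m. Qed.

Lemma tensm_compr (W X Y Z : C) (g : mor Y Z) (f : mor X Y) :
  (g ∘ f) ⊗m idm W = (g ⊗m idm W) ∘ (f ⊗m idm W).
Proof. by rewrite -tensm_comp comp1m. Qed.

Lemma isomorphic_tens (X X' Y Y' : C) :
  isomorphic X X' -> isomorphic Y Y' -> isomorphic (X ⊗ Y) (X' ⊗ Y').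
Proof. by move=> [f ?] [g ?]; exists (f ⊗m g); apply: iso_tensm. Qed.

Lemma isomorphic_assoc (X Y Z : C) : isomorphic (X ⊗ Y ⊗ Z) (X ⊗ (Y ⊗ Z)).
Proof. by exists (assoc X Y Z); apply: assoc_iso. Qed.

Lemma weakly_invertible_unit : weakly_invertible (tunit : C).
Proof. by exists tunit; split; exists (lunit tunit); apply: lunit_iso. Qed.

Lemma tens_cancel (X Y X' Y' : C) :
  isomorphic (X ⊗ X') tunit -> isomorphic (Y ⊗ Y') tunit ->
  isomorphic (X ⊗ Y ⊗ (Y' ⊗ X')) tunit.
Proof.
move=> XX' YY'.
apply: isomorphic_trans (isomorphic_assoc _ _ _) _.
apply: isomorphic_trans XX'; apply: isomorphic_tens (isomorphic_refl _) _.
apply: isomorphic_trans (isomorphic_sym (isomorphic_assoc _ _ _)) _.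
apply: (@isomorphic_trans _ _ (tunit ⊗ X')).
  exact: isomorphic_tens YY' (isomorphic_refl _).
by exists (lunit X'); apply: lunit_iso.
Qed.

Lemma weakly_invertible_tens (X Y : C) :
  weakly_invertible X -> weakly_invertible Y -> weakly_invertible (X ⊗ Y).
Proof.
move=> [X' [XX' X'X]] [Y' [YY' Y'Y]]; exists (Y' ⊗ X').
by split; apply: tens_cancel.
Qed.

(* The monoidal subcategory of weakly invertible objects and invertible
   morphisms. *)
Definition pic_ob := {X : C | weakly_invertible X}.
Definition pic_hom (X Y : pic_ob) := {f : mor (sval X) (sval Y) | is_iso f}.

Lemma pic_hom_eq (X Y : pic_ob) (f g : pic_hom X Y) : sval f = sval g -> f = g.
Proof. by case: f g => f ? [g ?] /= e; apply: eq_exist. Qed.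

Definition pic_id (X : pic_ob) : pic_hom X X := exist _ _ (iso_id (sval X)).
Definition pic_comp (X Y Z : pic_ob) (g : pic_hom Y Z) (f : pic_hom X Y) :
  pic_hom X Z := exist _ _ (iso_comp (svalP g) (svalP f)).

Definition pic_cat : category.
Proof.
refine (@Category pic_ob pic_hom pic_id pic_comp _ _ _).
- by move=> X Y f; apply: pic_hom_eq; apply: comp1m.
- by move=> X Y f; apply: pic_hom_eq; apply: compm1.
- by move=> X Y Z W h g f; apply: pic_hom_eq; apply: compmA.
Defined.

Definition pic_unit : pic_cat := exist _ _ weakly_invertible_unit.
Definition pic_tens (X Y : pic_cat) : pic_cat :=
  exist _ _ (weakly_invertible_tens (svalP X) (svalP Y)).
Definition pic_tensm (X X' Y Y' : pic_cat) (f : mor X X') (g : mor Y Y') :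
    mor (pic_tens X Y) (pic_tens X' Y') :=
  exist _ _ (iso_tensm (svalP f) (svalP g)).
Definition pic_assoc (X Y Z : pic_cat) :
    mor (pic_tens (pic_tens X Y) Z) (pic_tens X (pic_tens Y Z)) :=
  exist _ _ (assoc_iso (sval X) (sval Y) (sval Z)).
Definition pic_lunit (X : pic_cat) : mor (pic_tens pic_unit X) X :=
  exist _ _ (lunit_iso (sval X)).
Definition pic_runit (X : pic_cat) : mor (pic_tens X pic_unit) X :=
  exist _ _ (runit_iso (sval X)).

Lemma pic_iso (X Y : pic_cat) (f : mor X Y) : is_iso f.
Proof.
case: f => f [g [gf fg]]; have g_iso : is_iso g by exists f.
by exists (exist _ g g_iso); split; apply: pic_hom_eq.
Qed.

Definition pic : moncat.
Proof.
refine (@MonCat pic_cat pic_unit pic_tens pic_tensm pic_assoc pic_lunit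
          pic_runit _ _ _ _ _ _ _ _ _ _).
- by move=> *; apply: pic_hom_eq; apply: tensm_id.
- by move=> *; apply: pic_hom_eq; apply: tensm_comp.
- by move=> *; apply: pic_iso.
- by move=> *; apply: pic_iso.
- by move=> *; apply: pic_iso.
- by move=> *; apply: pic_hom_eq; apply: assoc_nat.
- by move=> *; apply: pic_hom_eq; apply: lunit_nat.
- by move=> *; apply: pic_hom_eq; apply: runit_nat.
- by move=> *; apply: pic_hom_eq; apply: triangle.
- by move=> *; apply: pic_hom_eq; apply: pentagon.
Defined.

End MonTheory.

Definition lands_in_pic (C D : moncat) (F : monfun C D) : Prop :=
  (forall X, weakly_invertible (F X)) /\
  (forall X Y (f : mor X Y), is_iso (fhom F f)).

Section Corestriction.
Variables (C D : moncat) (F : monfun C D) (FP : lands_in_pic F).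

Definition corestr_functor : functor C (pic D).
Proof.
refine (@Functor C (pic D) (fun X => exist _ (F X) (FP.1 X))
  (fun X Y f => exist _ (fhom F f) (FP.2 X Y f)) _ _).
- by move=> X; apply: pic_hom_eq; apply: fhom_id.
- by move=> X Y Z g f; apply: pic_hom_eq; apply: fhom_comp.
Defined.

Definition corestr : monfun C (pic D).
Proof.
refine (@MonFun C (pic D) corestr_functor (exist _ (munit F) (munit_iso F))
  (fun X Y => exist _ (mmul F X Y) (mmul_iso F X Y)) _ _ _ _ _ _).
- exact: pic_iso.
- by move=> *; apply: pic_iso.
- by move=> *; apply: pic_hom_eq; apply: mmul_nat.
- by move=> *; apply: pic_hom_eq; apply: mmul_assoc.
- by move=> *; apply: pic_hom_eq; apply: mmul_lunit.
- by move=> *; apply: pic_hom_eq; apply: mmul_runit.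
Defined.

End Corestriction.

Definition id_functor (C : category) : functor C C :=
  @Functor C C id (fun _ _ f => f) (fun _ => erefl) (fun _ _ _ _ _ => erefl).

Definition id_monfun (C : moncat) : monfun C C.
Proof.
refine (@MonFun C C (id_functor C) (idm tunit) (fun X Y => idm (X ⊗ Y))
          (iso_id _) (fun _ _ => iso_id _) _ _ _ _) => /=.
- by move=> X X' Y Y' f g; rewrite comp1m compm1.
- by move=> X Y Z; rewrite !tensm_id !compm1 !comp1m.
- by move=> X; rewrite tensm_id !compm1.
- by move=> X; rewrite tensm_id !compm1.
Defined.

Section CompMonfun.
Variables (B C D : moncat) (G : monfun C D) (F : monfun B C).

Definition comp_functor : functor B D.
Proof.
refine (@Functor B D (fun X => G (F X)) (fun X Y f => fhom G (fhom F f)) _ _).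
- by move=> X; rewrite !fhom_id.
- by move=> X Y Z g f; rewrite !fhom_comp.
Defined.

Definition comp_monfun : monfun B D.
Proof.
refine (@MonFun B D comp_functor (fhom G (munit F) ∘ munit G)
  (fun X Y => fhom G (mmul F X Y) ∘ mmul G (F X) (F Y)) _ _ _ _ _ _) => /=.
- by apply: iso_comp (munit_iso G); apply: fhom_iso; apply: munit_iso.
- by move=> X Y; apply: iso_comp (mmul_iso G _ _); apply: fhom_iso;
     apply: mmul_iso.
- move=> X X' Y Y' f g.
  by rewrite -compmA mmul_nat compmA -fhom_comp mmul_nat fhom_comp compmA.
- move=> X Y Z; rewrite tensm_compr tensm_compl -!(fhom_id G).
  rewrite -!compmA (compmA (mmul G _ _) (_ ⊗m fhom G _)) mmul_nat.
  rewrite !compmA -!fhom_comp mmul_assoc.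
  rewrite -(compmA (fhom G _) (mmul G _ _) (fhom G _ ⊗m _)) mmul_nat.
  by rewrite !fhom_comp -!compmA !fhom_id; congr (_ ∘ (_ ∘ _));
    rewrite !compmA mmul_assoc.
- move=> X; rewrite tensm_compr -(fhom_id G).
  rewrite -!compmA (compmA (mmul G _ _) (_ ⊗m fhom G _)) mmul_nat.
  by rewrite !compmA -!fhom_comp mmul_lunit fhom_id mmul_lunit.
- move=> X; rewrite tensm_compl -(fhom_id G).
  rewrite -!compmA (compmA (mmul G _ _) (fhom G _ ⊗m _)) mmul_nat.
  by rewrite !compmA -!fhom_comp mmul_runit fhom_id mmul_runit.
Defined.

End CompMonfun.

(* Monoidal equivalence: an equivalence in the 2-category of monoidal
   categories, monoidal functors and monoidal natural transformations. *)
Definition is_monoidal_equivalence (C D : moncat) (F : monfun C D) : Prop :=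
  exists G : monfun D C,
    monoidally_isomorphic (id_monfun C) (comp_monfun G F) /\
    monoidally_isomorphic (comp_monfun F G) (id_monfun D).

Definition is_2group_equivalence (C D : moncat) (F : monfun C D) : Prop :=
  [/\ is_2group C, is_2group D & is_monoidal_equivalence F].

Local Open Scope ring_scope.

(* Z/2-gradings: degrees are booleans, added with [addb]. *)
Definition is_grading (k : fieldType) (V : vectType k)
    (g : bool -> {vspace V}) : Prop :=
  (g false + g true = fullv)%VS /\ (g false :&: g true = 0)%VS.

Notation bilin f := (bilinear_for *:%R *:%R f).

(* The carrier is a bare [vectType] rather than a [falgType], because the
   latter excludes the zero algebra. *)
Record superAlg (k : fieldType) := SuperAlg {
  salg_vect :> vectType k;
  smul : salg_vect -> salg_vect -> salg_vect;
  sone : salg_vect;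
  spar : bool -> {vspace salg_vect};
  smul_bilin : bilin smul;
  smulA : associative smul;
  smul1 : left_id sone smul;
  smulr1 : right_id sone smul;
  spar_grading : is_grading spar;
  spar1 : sone \in spar false;
  sparM : forall i j x y,
    x \in spar i -> y \in spar j -> smul x y \in spar (i (+) j)
}.
Arguments smul {k s} x y.
Arguments sone {k s}.
Arguments spar {k s} i.
Notation "x · y" := (smul x y) (at level 40, left associativity) : ring_scope.

Record bimod (k : fieldType) (A : superAlg k) := Bimod {
  bmod :> vectType k;
  lact : A -> bmod -> bmod;
  ract : bmod -> A -> bmod;
  bpar : bool -> {vspace bmod};
  lact_bilin : bilin lact;
  ract_bilin : bilin ract;
  lact1 : forall m, lact sone m = m;
  ract1 : forall m, ract m sone = m;
  lactM : forall a b m, lact (a · b) m = lact a (lact b m);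
  ractM : forall m a b, ract m (a · b) = ract (ract m a) b;
  lact_ract : forall a m b, ract (lact a m) b = lact a (ract m b);
  bpar_grading : is_grading bpar;
  bpar_lact : forall i j a m,
    a \in spar i -> m \in bpar j -> lact a m \in bpar (i (+) j);
  bpar_ract : forall i j m a,
    m \in bpar i -> a \in spar j -> ract m a \in bpar (i (+) j)
}.
Arguments lact {k A b} a m : rename.
Arguments ract {k A b} m a : rename.
Arguments bpar {k A b} i : rename.
Notation "a ▷ m" := (lact a m) (at level 38, right associativity) : ring_scope.
Notation "m ◁ a" := (ract m a) (at level 37, left associativity) : ring_scope.

Record is_intertwiner (k : fieldType) (A : superAlg k) (M N : bimod A)
    (f : 'Hom(M, N)) : Prop := {
  itw_lact : forall a m, f (a ▷ m) = a ▷ f m;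
  itw_ract : forall m a, f (m ◁ a) = f m ◁ a;
  itw_even : forall i m, m \in bpar i -> f m \in bpar i
}.

Record intertwiner (k : fieldType) (A : superAlg k) (M N : bimod A) :=
  Intertwiner { itw :> 'Hom(M, N); itwP : is_intertwiner itw }.

Section Grading.
Variables (k : fieldType) (V : vectType k) (g : bool -> {vspace V}).
Hypothesis gP : is_grading g.

Lemma grading_split v : exists u : bool -> V,
  (forall i, u i \in g i) /\ v = u false + u true.
Proof.
have : v \in (g false + g true)%VS by rewrite gP.1 memvf.
move=> /memv_addP[u0 u0P [u1 u1P ->]].
by exists (fun i => if i then u1 else u0); split=> // -[].
Qed.

Lemma grading_disjoint v : v \in g false -> v \in g true -> v = 0.
Proof.
by move=> v0 v1; apply/eqP; rewrite -memv0 -gP.2 memv_cap v0 v1.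
Qed.

Lemma grading_inj (u w : bool -> V) :
  (forall i, u i \in g i) -> (forall i, w i \in g i) ->
  u false + u true = w false + w true -> forall i, u i = w i.
Proof.
move=> uP wP e.
have d : u false - w false = w true - u true.
  by apply/eqP; rewrite subr_eq addrAC [w true + _]addrC -e addrK.
have z0 : u false - w false = 0.
  by apply: grading_disjoint; [rewrite memvB | rewrite d memvB].
by case; apply/eqP; rewrite -subr_eq0; [rewrite -opprB -d z0 oppr0 | rewrite z0].
Qed.

Definition gproj (i : bool) : 'End(V) := daddv_pi (g i) (g (~~ i)).

Lemma gproj_disj i : (g i :&: g (~~ i) = 0)%VS.
Proof. by case: i; [rewrite capvC|]; apply: gP.2. Qed.

Lemma gproj_mem i v : gproj i v \in g i.
Proof. exact: memv_pi. Qed.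

Lemma gproj_split v : v = gproj false v + gproj true v.
Proof.
by rewrite daddv_pi_add ?(gproj_disj false)// gP.1 memvf.
Qed.

Lemma gproj_id i j v : v \in g j -> gproj i v = if i == j then v else 0.
Proof.
move=> vj.
have P (i0 : bool) : (if i0 == j then v else 0) \in g i0.
  by case: eqP => [->//|_]; rewrite mem0v.
apply: (grading_inj (fun i => gproj_mem i v) P).
by rewrite -gproj_split; case: j {vj P} => /=; rewrite ?add0r ?addr0.
Qed.

End Grading.

Section Bilin.
Variables (k : fieldType) (U V W : lmodType k) (f : U -> V -> W).
Hypothesis fP : bilin f.

Lemma bilinl y : linear (f^~ y). Proof. exact: fP.1. Qed.
Lemma bilinr x : linear (f x). Proof. exact: fP.2. Qed.
Lemma bilinDl x x' y : f (x + x') y = f x y + f x' y.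
Proof. by have := bilinl y 1 x x'; rewrite !scale1r. Qed.
Lemma bilinDr x y y' : f x (y + y') = f x y + f x y'.
Proof. by have := bilinr x 1 y y'; rewrite !scale1r. Qed.
Lemma bilin0l y : f 0 y = 0.
Proof. by apply: (addrI (f 0 y)); rewrite -bilinDl !addr0. Qed.
Lemma bilin0r x : f x 0 = 0.
Proof. by apply: (addrI (f x 0)); rewrite -bilinDr !addr0. Qed.
Lemma bilinZl c x y : f (c *: x) y = c *: f x y.
Proof. by have := bilinl y c x 0; rewrite !addr0 bilin0l addr0. Qed.
Lemma bilinZr c x y : f x (c *: y) = c *: f x y.
Proof. by have := bilinr x c y 0; rewrite !addr0 bilin0r addr0. Qed.
Lemma bilin_suml I (r : seq I) (F : I -> U) y :
  f (\sum_(i <- r) F i) y = \sum_(i <- r) f (F i) y.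
Proof.
by elim: r => [|i r IH]; rewrite !(big_nil, big_cons) ?bilin0l// bilinDl IH.
Qed.
Lemma bilin_sumr I (r : seq I) (F : I -> V) x :
  f x (\sum_(i <- r) F i) = \sum_(i <- r) f x (F i).
Proof.
by elim: r => [|i r IH]; rewrite !(big_nil, big_cons) ?bilin0r// bilinDr IH.
Qed.

End Bilin.

Section MkLin.
Variables (k : fieldType) (U V : vectType k).
(* [linfun], with the linearity proof as an explicit argument. *)
Definition mklin (f : U -> V) (_ : linear f) : 'Hom(U, V) := linfun f.
Lemma mklinE (f : U -> V) (fP : linear f) x : mklin fP x = f x.
Proof.
pose fL := GRing.isLinear.Build k U V *:%R f fP.
pose F : {linear U -> V} := HB.pack f fL.
exact: (lfunE F).
Qed.
Lemma sub_lfunE (f g : 'Hom(U, V)) x : (f - g) x = f x - g x.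
Proof. by rewrite add_lfunE opp_lfunE. Qed.
End MkLin.

Section IntertwinerTheory.
Variables (k : fieldType) (A : superAlg k).

Lemma intertwiner_eq (M N : bimod A) (f g : intertwiner M N) :
  itw f =1 itw g -> f = g.
Proof.
case: f g => f fP [g gP] /= /lfunP e; rewrite e in fP *.
by congr Intertwiner; apply: Prop_irrelevance.
Qed.

Lemma id_intertwiner_subproof (M : bimod A) : is_intertwiner (\1%VF : 'Hom(M, M)).
Proof. by split=> *; rewrite !id_lfunE. Qed.
Definition id_intertwiner (M : bimod A) : intertwiner M M :=
  Intertwiner (id_intertwiner_subproof M).

Lemma comp_intertwiner_subproof (M N P : bimod A)
  (g : intertwiner N P) (f : intertwiner M N) : is_intertwiner (g \o f)%VF.
Proof.
case: g f => g gP [f fP]; split=> [a m|m a|i m mi]; rewrite !comp_lfunE /=.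
- by rewrite (itw_lact fP) (itw_lact gP).
- by rewrite (itw_ract fP) (itw_ract gP).
- exact/(itw_even gP)/(itw_even fP).
Qed.
Definition comp_intertwiner (M N P : bimod A)
    (g : intertwiner N P) (f : intertwiner M N) : intertwiner M P :=
  Intertwiner (comp_intertwiner_subproof g f).

Definition bimod_cat : category.
Proof.
refine (@Category (bimod A) (@intertwiner k A) id_intertwiner comp_intertwiner
  _ _ _).
- by move=> M N f; apply: intertwiner_eq => x; rewrite /= !lfunE/= lfunE.
- by move=> M N f; apply: intertwiner_eq => x; rewrite /= !lfunE/= lfunE.
- by move=> M N P Q h g f; apply: intertwiner_eq => x; rewrite /= !comp_lfunE.
Defined.

Lemma intertwiner_iso (M N : bimod A) (f : intertwiner M N) (g : 'Hom(N, M)) :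
  cancel f g -> cancel g f -> @is_iso bimod_cat M N f.
Proof.
move=> fK gK; have fP := itwP f.
have gP : is_intertwiner g.
  split=> [a n|n a|i n ni].
  - by rewrite -{1}[n]gK -(itw_lact fP) fK.
  - by rewrite -{1}[n]gK -(itw_ract fP) fK.
  - have [u [uP eu]] := grading_split (bpar_grading M) (g n).
    have fu j : f (u j) = if j == i then n else 0.
      apply: (grading_inj (bpar_grading N) (u := fun j => f (u j))
               (w := fun j => if j == i then n else 0)).
      + by move=> {}j; apply: (itw_even fP); apply: uP.
      + by move=> {}j; case: eqP => [->//|_]; rewrite mem0v.
      + have := congr1 f eu; rewrite gK linearD => <-.
        by case: (i) => /=; rewrite ?addr0 ?add0r.
    have uz : u (~~ i) = 0.
      by rewrite -[u _]fK fu; case: (i); rewrite /= linear0.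
    suff -> : g n = u i by [].
    by rewrite eu; case: (i) uz => /= ->; rewrite ?addr0 ?add0r.
exists (Intertwiner gP); split; apply: intertwiner_eq => x.
  by rewrite /= comp_lfunE id_lfunE fK.
by rewrite /= comp_lfunE id_lfunE gK.
Qed.

End IntertwinerTheory.

(* The relative tensor product over A.  The space M ⊗_k N is realised by
   matrices of coordinates, [ktens m n] being the elementary tensor; the
   quotient by [tens_rel], the span of the m a ⊗ n - m ⊗ a n (which are
   trilinear, so that basis vectors suffice), is realised by a complement of
   [tens_rel], [tens_quo] being the quotient map.  The universal property is
   [tlift_pure] and [tens_bimod_ext] below. *)
Section Tensor.
Variables (k : fieldType) (A : superAlg k) (M N : bimod A).

Local Notation eM := (vbasis {:M}).
Local Notation eN := (vbasis {:N}).
Local Notation eA := (vbasis {:A}).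
Local Notation MN := 'M[k]_(\dim {:M}, \dim {:N}).

Definition ktens (m : M) (n : N) : MN :=
  \matrix_(i, j) (coord eM i m * coord eN j n).

Definition tens_rel : {vspace MN} :=
  (\sum_(i < \dim {:M}) \sum_(l < \dim {:A}) \sum_(j < \dim {:N})
     <[ktens (eM`_i ◁ eA`_l) eN`_j - ktens eM`_i (eA`_l ▷ eN`_j)]>)%VS.

Definition tens_vect : vectType k := subvs_of (tens_rel^C)%VS.

Definition tens_quo (X : MN) : tens_vect :=
  vsproj _ (daddv_pi (tens_rel^C)%VS tens_rel X).

Definition telt (m : M) (n : N) : tens_vect := tens_quo (ktens m n).

Lemma ktens_bilin : bilin ktens.
Proof.
split=> [n|m] c x y; apply/matrixP=> i j; rewrite !mxE linearP /=.
  by rewrite mulrDl mulrA.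
by rewrite mulrDr mulrCA.
Qed.

Lemma tens_quo_linear : linear tens_quo.
Proof. by move=> c X Y; rewrite /tens_quo !linearP. Qed.

Lemma telt_bilin : bilin telt.
Proof.
by split=> [n|m] c x y; rewrite /telt -tens_quo_linear;
  rewrite (ktens_bilin.1, ktens_bilin.2).
Qed.

Lemma tens_rel_disj : (tens_rel^C :&: tens_rel = 0)%VS.
Proof. by rewrite capvC capv_compl. Qed.

Lemma tens_rel_split (X : MN) :
  daddv_pi (tens_rel^C)%VS tens_rel X + daddv_pi tens_rel (tens_rel^C)%VS X
  = X.
Proof.
apply: daddv_pi_add; first exact: tens_rel_disj.
by rewrite addvC addv_complf memvf.
Qed.

Lemma tens_quo_rel X : X \in tens_rel -> tens_quo X = 0.
Proof.
move=> XR; rewrite /tens_quo.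
suff -> : daddv_pi (tens_rel^C)%VS tens_rel X = 0 by rewrite linear0.
have := tens_rel_split X.
rewrite (daddv_pi_id (capv_compl _) XR) => e.
by apply: (addIr X); rewrite e add0r.
Qed.

Lemma tens_quo_eqmod X : X - vsval (tens_quo X) \in tens_rel.
Proof.
rewrite /tens_quo vsprojK ?memv_pi//.
by rewrite -{1}(tens_rel_split X) addrAC subrr add0r memv_pi.
Qed.

Lemma tens_quoK (t : tens_vect) : tens_quo (vsval t) = t.
Proof.
rewrite /tens_quo (daddv_pi_id tens_rel_disj) ?vsvalK//.
exact: subvsP.
Qed.

Lemma ktens_basis (i : 'I_(\dim {:M})) (j : 'I_(\dim {:N})) :
  ktens eM`_i eN`_j = delta_mx i j.
Proof.
apply/matrixP=> i' j'.
rewrite !mxE !coord_free ?(basis_free (vbasisP _))//.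
by rewrite -natrM mulnb [i == _]eq_sym [j == _]eq_sym.
Qed.

Lemma ktens_span (X : MN) :
  X = \sum_i \sum_j X i j *: ktens eM`_i eN`_j.
Proof.
rewrite {1}[X]matrix_sum_delta; apply: eq_bigr => i _; apply: eq_bigr => j _.
by rewrite ktens_basis.
Qed.

Lemma telt_bal m a n : telt (m ◁ a) n = telt m (a ▷ n).
Proof.
rewrite (coord_vbasis (memvf m)) (coord_vbasis (memvf a))
  (coord_vbasis (memvf n)).
have tB := telt_bilin; have rB := ract_bilin M; have lB := lact_bilin N.
rewrite (bilin_suml rB) !(bilin_suml tB); apply: eq_bigr => i _.
rewrite (bilin_sumr rB) (bilin_suml lB) (bilin_suml tB) (bilin_sumr tB).
apply: eq_bigr => l _.
rewrite (bilin_sumr lB) !(bilin_sumr tB); apply: eq_bigr => j _.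
rewrite !(bilinZl lB) !(bilinZr lB) !(bilinZl rB) !(bilinZr rB).
rewrite !(bilinZl tB) !(bilinZr tB) !scalerA.
congr (_ *: _).
apply/eqP; rewrite -subr_eq0 /telt.
rewrite -[X in _ - X]scale1r -scaleNr addrC -tens_quo_linear scaleN1r addrC.
rewrite tens_quo_rel//.
rewrite memvE; apply: (sumv_sup i) => //; apply: (sumv_sup l) => //.
exact: (sumv_sup j).
Qed.

Section Lift.
Variables (W : vectType k) (f : M -> N -> W).

Definition klift (X : MN) : W := \sum_i \sum_j X i j *: f eM`_i eN`_j.

Lemma klift_linear : linear klift.
Proof.
move=> c X Y; rewrite /klift scaler_sumr -big_split /=; apply: eq_bigr => i _.
rewrite scaler_sumr -big_split /=; apply: eq_bigr => j _.
by rewrite !mxE scalerDl scalerA.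
Qed.

Lemma tens_lift_subproof : linear (fun t : tens_vect => klift (vsval t)).
Proof. by move=> c x y; rewrite linearP klift_linear. Qed.

Definition tens_lift : 'Hom(tens_vect, W) := mklin tens_lift_subproof.

Hypothesis f_bilin : bilin f.
Hypothesis f_bal : forall m a n, f (m ◁ a) n = f m (a ▷ n).

Lemma klift_ktens m n : klift (ktens m n) = f m n.
Proof.
rewrite /klift [in RHS](coord_vbasis (memvf m)) [in RHS](coord_vbasis (memvf n)).
rewrite (bilin_suml f_bilin); apply: eq_bigr => i _.
rewrite (bilin_sumr f_bilin); apply: eq_bigr => j _.
by rewrite mxE (bilinZl f_bilin) (bilinZr f_bilin) scalerA.
Qed.

Lemma klift_rel X : X \in tens_rel -> klift X = 0.
Proof.
rewrite -(mklinE klift_linear) => XR; apply/eqP; rewrite -memv_ker.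
move: X XR; apply/subvP.
apply/subv_sumP => i _; apply/subv_sumP => l _; apply/subv_sumP => j _.
rewrite -memvE memv_ker linearB /= !mklinE !klift_ktens f_bal subrr.
exact: eqxx.
Qed.

Lemma tens_lift_pure m n : tens_lift (telt m n) = f m n.
Proof.
rewrite mklinE -[RHS]klift_ktens.
have /klift_rel := tens_quo_eqmod (ktens m n).
set X := ktens m n; move=> e.
have := klift_linear 1 (X - vsval (tens_quo X)) (vsval (tens_quo X)).
by rewrite scale1r subrK e scaler0 add0r => ->.
Qed.

End Lift.

Lemma tens_ind (S : {vspace tens_vect}) :
  (forall m n, telt m n \in S) -> S = fullv.
Proof.
move=> SP; apply/eqP; rewrite eqEsubv subvf; apply/subvP => t _ /=.
rewrite -(tens_quoK t) [vsval t]ktens_span.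
have -> : tens_quo = mklin tens_quo_linear :> (_ -> _).
  by apply: funext => X; rewrite mklinE.
rewrite linear_sum rpred_sum// => i _; rewrite linear_sum rpred_sum// => j _.
by rewrite linearZ memvZ//= mklinE SP.
Qed.

Lemma tens_ext (W : vectType k) (f g : 'Hom(tens_vect, W)) :
  (forall m n, f (telt m n) = g (telt m n)) -> f = g.
Proof.
move=> fg; apply/lfunP => t; apply/eqP; rewrite -subr_eq0 -sub_lfunE -memv_ker.
rewrite (@tens_ind (lker (f - g))) ?memvf// => m n.
by rewrite memv_ker sub_lfunE subr_eq0 fg.
Qed.

Definition tens_lact (a : A) : 'End(tens_vect) :=
  tens_lift (fun m n => telt (a ▷ m) n).
Definition tens_ract (a : A) : 'End(tens_vect) :=
  tens_lift (fun m n => telt m (n ◁ a)).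

(* The degree i part is spanned by the m ⊗ n with deg m = j, deg n = j + i. *)
Definition tens_par (i : bool) : {vspace tens_vect} :=
  (\sum_(j : bool) <<[seq telt m n | m <- vbasis (@bpar _ _ M j),
                                      n <- vbasis (@bpar _ _ N (j (+) i))]>>)%VS.

Lemma tens_lact_pure a m n : tens_lact a (telt m n) = telt (a ▷ m) n.
Proof.
rewrite tens_lift_pure//; last by move=> *; rewrite -lact_ract telt_bal.
split=> [y|x] c u v /=; last by rewrite (bilinr telt_bilin).
by rewrite (bilinr (lact_bilin M)) (bilinl telt_bilin).
Qed.

Lemma tens_ract_pure a m n : tens_ract a (telt m n) = telt m (n ◁ a).
Proof.
rewrite tens_lift_pure//; last by move=> *; rewrite telt_bal lact_ract.
split=> [y|x] c u v /=; first by rewrite (bilinl telt_bilin).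
by rewrite (bilinl (ract_bilin N)) (bilinr telt_bilin).
Qed.

Lemma tens_par_pure i j m n :
  m \in bpar i -> n \in bpar j -> telt m n \in tens_par (i (+) j).
Proof.
move=> mi nj; rewrite (coord_vbasis mi) (coord_vbasis nj).
rewrite (bilin_suml telt_bilin) rpred_sum// => p _.
rewrite (bilin_sumr telt_bilin) rpred_sum// => q _.
rewrite (bilinZl telt_bilin) (bilinZr telt_bilin) !memvZ//.
apply: (subvP (sumv_sup i _ (subvv _))) => //.
apply: memv_span; apply/allpairsP.
exists ((vbasis (bpar i))`_p, (vbasis (bpar j))`_q) => /=.
rewrite addKb; split=> //; apply: mem_nth; by rewrite size_tuple.
Qed.

Lemma tens_par_ind i (S : {vspace tens_vect}) :
  (forall j m n, m \in bpar j -> n \in bpar (j (+) i) -> telt m n \in S) ->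
  (tens_par i <= S)%VS.
Proof.
move=> SP; apply/subv_sumP => j _; apply/span_subvP => t /allpairsP[[m n] /=].
by move=> [mj nj ->]; apply: SP (vbasis_mem mj) (vbasis_mem nj).
Qed.

Lemma bpar_split (P : bimod A) (x : P) : exists u : bool -> P,
  (forall i, u i \in bpar i) /\ x = u false + u true.
Proof. exact: grading_split (bpar_grading P) x. Qed.

Let gp (P : bimod A) (i : bool) : 'End(P) := gproj (@bpar _ _ P) i.

Lemma tens_proj_bal (i : bool) m a n :
  \sum_(j : bool) telt (gp M j (m ◁ a)) (gp N (j (+) i) n)
  = \sum_(j : bool) telt (gp M j m) (gp N (j (+) i) (a ▷ n)).
Proof.
have tB := telt_bilin; have rB := ract_bilin M; have lB := lact_bilin N.
have [u [uP ->]] := bpar_split m; have [v [vP ->]] := bpar_split n.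
have [b [bP ->]] := grading_split (spar_grading A) a.
rewrite !(bilinDl rB, bilinDr rB, bilinDl lB, bilinDr lB) !big_bool.
rewrite !linearD /=.
have e (j p q : bool) : gp M j (u p ◁ b q) =
    if j == p (+) q then u p ◁ b q else 0.
  by apply: gproj_id; [apply: bpar_grading | apply: bpar_ract].
have e' (j p q : bool) : gp N j (b p ▷ v q) =
    if j == p (+) q then b p ▷ v q else 0.
  by apply: gproj_id; [apply: bpar_grading | apply: bpar_lact].
have eu (j p : bool) : gp M j (u p) = if j == p then u p else 0.
  by apply: gproj_id; [apply: bpar_grading |].
have ev (j p : bool) : gp N j (v p) = if j == p then v p else 0.
  by apply: gproj_id; [apply: bpar_grading |].
rewrite !(e, e', eu, ev).
case: i => /=; rewrite ?(addr0, add0r) !(bilinDl tB, bilinDr tB) !telt_bal;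
  by rewrite [LHS](AC (2*2) ((2*4)*(3*1))).
Qed.

Lemma tens_par_grading : is_grading tens_par.
Proof.
have tB := telt_bilin.
split.
  apply: tens_ind => m n.
  have [u [uP ->]] := bpar_split m; have [v [vP ->]] := bpar_split n.
  rewrite !(bilinDl tB, bilinDr tB).
  have P i j : telt (u i) (v j) \in (tens_par false + tens_par true)%VS.
    have := tens_par_pure (uP i) (vP j).
    by case: (i (+) j); apply: subvP; rewrite (addvSr, addvSl).
  by rewrite !memvD.
pose p := tens_lift
  (fun m n => \sum_(j : bool) telt (gp M j m) (gp N (j (+) false) n)).
have pE m n : p (telt m n)
    = \sum_(j : bool) telt (gp M j m) (gp N (j (+) false) n).
  rewrite /p tens_lift_pure//; last exact: tens_proj_bal.
  split=> [y|x] c a b; rewrite !big_bool /= !linearP /=.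
    by rewrite !(bilinl tB) scalerDr addrACA.
  by rewrite !(bilinr tB) scalerDr addrACA.
have p0 : (tens_par false <= lker (p - \1%VF))%VS.
  apply: tens_par_ind => j m n mj nj.
  rewrite memv_ker sub_lfunE id_lfunE pE big_bool /=.
  rewrite /gp !(gproj_id (bpar_grading _) _ mj) !(gproj_id (bpar_grading _) _ nj).
  by case: j {mj nj} => /=; rewrite ?(bilin0l tB) ?(addr0, add0r) subrr.
have p1 : (tens_par true <= lker p)%VS.
  apply: tens_par_ind => j m n mj nj.
  rewrite memv_ker pE big_bool /=.
  rewrite /gp !(gproj_id (bpar_grading _) _ mj) !(gproj_id (bpar_grading _) _ nj).
  by case: j {mj nj} => /=; rewrite ?(bilin0l tB) ?(bilin0r tB) ?(addr0, add0r).
apply/eqP; rewrite -subv0; apply/subvP => t; rewrite memv_cap => /andP[t0 t1].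
have := subvP p0 _ t0; have := subvP p1 _ t1; rewrite !memv_ker sub_lfunE.
by rewrite id_lfunE => /eqP->; rewrite sub0r oppr_eq0 memv0.
Qed.

Let tB := telt_bilin.

Fact tens_lact_bilin : bilin (fun a t => tens_lact a t).
Proof.
split=> [t|a] c x y /=; last by rewrite linearP.
rewrite -scale_lfunE -add_lfunE; congr (fun_of_lfun _ t).
apply: tens_ext => m n; rewrite add_lfunE scale_lfunE !tens_lact_pure.
by rewrite (bilinl (lact_bilin M)) (bilinl tB).
Qed.

Fact tens_ract_bilin : bilin (fun t a => tens_ract a t).
Proof.
split=> [a|t] c x y /=; first by rewrite linearP.
rewrite -scale_lfunE -add_lfunE; congr (fun_of_lfun _ t).
apply: tens_ext => m n; rewrite add_lfunE scale_lfunE !tens_ract_pure.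
by rewrite (bilinr (ract_bilin N)) (bilinr tB).
Qed.

Fact tens_lact1 t : tens_lact sone t = t.
Proof.
rewrite -[RHS]id_lfunE; congr (fun_of_lfun _ t).
by apply: tens_ext => m n; rewrite id_lfunE tens_lact_pure lact1.
Qed.

Fact tens_ract1 t : tens_ract sone t = t.
Proof.
rewrite -[RHS]id_lfunE; congr (fun_of_lfun _ t).
by apply: tens_ext => m n; rewrite id_lfunE tens_ract_pure ract1.
Qed.

Fact tens_lactM a b t : tens_lact (a · b) t = tens_lact a (tens_lact b t).
Proof.
rewrite -comp_lfunE; congr (fun_of_lfun _ t).
by apply: tens_ext => m n; rewrite comp_lfunE !tens_lact_pure lactM.
Qed.

Fact tens_ractM t a b : tens_ract (a · b) t = tens_ract b (tens_ract a t).
Proof.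
rewrite -comp_lfunE; congr (fun_of_lfun _ t).
by apply: tens_ext => m n; rewrite comp_lfunE !tens_ract_pure ractM.
Qed.

Fact tens_lact_ract a t b :
  tens_ract b (tens_lact a t) = tens_lact a (tens_ract b t).
Proof.
rewrite -!comp_lfunE; congr (fun_of_lfun _ t).
by apply: tens_ext => m n; rewrite !comp_lfunE !(tens_lact_pure, tens_ract_pure).
Qed.

Fact tens_par_lact i j a t :
  a \in spar i -> t \in tens_par j -> tens_lact a t \in tens_par (i (+) j).
Proof.
move=> ai tj; move: t tj.
suff : (tens_par j <= tens_lact a @^-1: tens_par (i (+) j))%VS.
  by move=> /subvP S t /S; rewrite memv_preim.
apply: tens_par_ind => l m n ml nl; rewrite -memv_preim tens_lact_pure.
by have := tens_par_pure (bpar_lact ai ml) nl; rewrite -addbA addKb.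
Qed.

Fact tens_par_ract i j t a :
  t \in tens_par i -> a \in spar j -> tens_ract a t \in tens_par (i (+) j).
Proof.
move=> ti aj; move: t ti.
suff : (tens_par i <= tens_ract a @^-1: tens_par (i (+) j))%VS.
  by move=> /subvP S t /S; rewrite memv_preim.
apply: tens_par_ind => l m n ml nl; rewrite -memv_preim tens_ract_pure.
by have := tens_par_pure ml (bpar_ract nl aj); rewrite -addbA addKb.
Qed.

Definition tens_bimod : bimod A :=
  @Bimod k A tens_vect (fun a t => tens_lact a t) (fun t a => tens_ract a t)
    tens_par tens_lact_bilin tens_ract_bilin tens_lact1 tens_ract1 tens_lactM
    tens_ractM tens_lact_ract tens_par_grading tens_par_lact tens_par_ract.

End Tensor.

Lemma lactP (k : fieldType) (A : superAlg k) (M : bimod A) a c (x y : M) :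
  a ▷ (c *: x + y) = c *: (a ▷ x) + a ▷ y.
Proof. exact: bilinr (lact_bilin M) _ _ _ _. Qed.

Lemma ractP (k : fieldType) (A : superAlg k) (M : bimod A) a c (x y : M) :
  (c *: x + y) ◁ a = c *: (x ◁ a) + y ◁ a.
Proof. exact: bilinl (ract_bilin M) _ _ _ _. Qed.

Section TensorBimod.
Variables (k : fieldType) (A : superAlg k) (M N : bimod A).

Definition tpure (m : M) (n : N) : tens_bimod M N := telt m n.
Definition tlift (W : vectType k) (f : M -> N -> W) : 'Hom(tens_bimod M N, W) :=
  tens_lift f.

Lemma tpure_bilin : bilin tpure. Proof. exact: telt_bilin. Qed.
Lemma tpure_bal m a n : tpure (m ◁ a) n = tpure m (a ▷ n).
Proof. exact: telt_bal. Qed.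
Lemma tpure_lact a m n : a ▷ tpure m n = tpure (a ▷ m) n.
Proof. exact: tens_lact_pure. Qed.
Lemma tpure_ract a m n : tpure m n ◁ a = tpure m (n ◁ a).
Proof. exact: tens_ract_pure. Qed.
Lemma tpure_par i j m n :
  m \in bpar i -> n \in bpar j -> tpure m n \in bpar (i (+) j).
Proof. exact: tens_par_pure. Qed.

Lemma tlift_pure (W : vectType k) (f : M -> N -> W) :
  bilin f -> (forall m a n, f (m ◁ a) n = f m (a ▷ n)) ->
  forall m n, tlift f (tpure m n) = f m n.
Proof. exact: tens_lift_pure. Qed.

Lemma tpurePl n c x y : tpure (c *: x + y) n = c *: tpure x n + tpure y n.
Proof. exact: bilinl tpure_bilin _ _ _ _. Qed.
Lemma tpurePr m c x y : tpure m (c *: x + y) = c *: tpure m x + tpure m y.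
Proof. exact: bilinr tpure_bilin _ _ _ _. Qed.

Lemma tens_bimod_ext (W : vectType k) (F G : tens_bimod M N -> W) :
  linear F -> linear G -> (forall m n, F (tpure m n) = G (tpure m n)) ->
  F =1 G.
Proof.
move=> FL GL FG t; rewrite -(mklinE FL) -(mklinE GL).
have -> // : mklin FL = mklin GL.
by apply: tens_ext => m n; rewrite !mklinE; apply: FG.
Qed.

Lemma tens_bimod_par_ind i (S : {vspace (tens_bimod M N)}) :
  (forall j m n, m \in bpar j -> n \in bpar (j (+) i) -> tpure m n \in S) ->
  {subset bpar i <= S}.
Proof. by move=> SP; apply/subvP; apply: tens_par_ind. Qed.

End TensorBimod.

Ltac lin :=
  by move=> ? ? ? /=; rewrite ?(linearP, lactP, ractP, tpurePl, tpurePr).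

Lemma linear_comb (k : fieldType) (U W : lmodType k) c (f g : U -> W) :
  linear f -> linear g -> linear (fun t => c *: f t + g t).
Proof.
move=> fL gL d u v /=; rewrite fL gL !scalerDr !scalerA addrACA.
by rewrite [c * d]mulrC.
Qed.

Section EndCategory.
Variables (k : fieldType) (A : superAlg k).

Definition reg_bimod : bimod A :=
  @Bimod k A A (@smul k A) (@smul k A) (@spar k A) (smul_bilin A)
    (smul_bilin A) (@smul1 k A) (@smulr1 k A)
    (fun a b m => esym (smulA a b m)) (fun m a b => smulA m a b)
    (fun a m b => esym (smulA a m b)) (spar_grading A) (@sparM k A) (@sparM k A).

Lemma itw_tens_subproof (M N P : bimod A) (f : M -> N -> P) :
  bilin f -> (forall m a n, f (m ◁ a) n = f m (a ▷ n)) ->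
  (forall a m n, f (a ▷ m) n = a ▷ f m n) ->
  (forall m n a, f m (n ◁ a) = f m n ◁ a) ->
  (forall i j m n, m \in bpar i -> n \in bpar j -> f m n \in bpar (i (+) j)) ->
  is_intertwiner (tlift f).
Proof.
move=> fB fbal fl fr fe.
have fE := tlift_pure fB fbal.
split.
- move=> a; apply: tens_bimod_ext; [lin|lin|] => m n.
  by rewrite tpure_lact !fE fl.
- move=> + a; apply: tens_bimod_ext; [lin|lin|] => m n.
  by rewrite tpure_ract !fE fr.
- move=> i t ti.
  have -> : (tlift f t \in bpar i) = (t \in (tlift f @^-1: bpar i)%VS).
    by rewrite memv_preim.
  move: ti; apply: tens_bimod_par_ind => j m n mj nj.
  by rewrite -memv_preim fE; have := fe _ _ _ _ mj nj; rewrite addKb.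
Qed.

Definition itw_tens (M N P : bimod A) (f : M -> N -> P) fB fbal fl fr fe :
    intertwiner (tens_bimod M N) P :=
  Intertwiner (@itw_tens_subproof M N P f fB fbal fl fr fe).

Lemma itw_tensE (M N P : bimod A) (f : M -> N -> P) fB fbal fl fr fe m n :
  @itw_tens M N P f fB fbal fl fr fe (tpure m n) = f m n.
Proof. exact: tlift_pure. Qed.

Lemma itw_ext (M N P : bimod A) (f g : intertwiner (tens_bimod M N) P) :
  (forall m n, f (tpure m n) = g (tpure m n)) -> f = g.
Proof.
by move=> fg; apply: intertwiner_eq; apply: tens_bimod_ext; [lin|lin|].
Qed.

Section TensMor.
Variables (M M' N N' : bimod A) (f : intertwiner M M') (g : intertwiner N N').

Let tm (m : M) (n : N) : tens_bimod M' N' := tpure (f m) (g n).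

Fact tm1 : bilin tm.
Proof. by split=> ?; rewrite /tm; lin. Qed.
Fact tm2 m a n : tm (m ◁ a) n = tm m (a ▷ n).
Proof. by rewrite /tm (itw_ract (itwP f)) (itw_lact (itwP g)) tpure_bal. Qed.
Fact tm3 a m n : tm (a ▷ m) n = a ▷ tm m n.
Proof. by rewrite /tm (itw_lact (itwP f)) tpure_lact. Qed.
Fact tm4 m n a : tm m (n ◁ a) = tm m n ◁ a.
Proof. by rewrite /tm (itw_ract (itwP g)) tpure_ract. Qed.
Fact tm5 i j m n : m \in bpar i -> n \in bpar j -> tm m n \in bpar (i (+) j).
Proof.
by move=> mi nj; apply: tpure_par;
  [apply: (itw_even (itwP f)) | apply: (itw_even (itwP g))].
Qed.

Definition itw_tensm : intertwiner (tens_bimod M N) (tens_bimod M' N') :=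
  itw_tens tm1 tm2 tm3 tm4 tm5.
Lemma itw_tensmE m n : itw_tensm (tpure m n) = tpure (f m) (g n).
Proof. exact: itw_tensE. Qed.

End TensMor.

Section Unitors.
Variable M : bimod A.

Definition itw_lunit : intertwiner (tens_bimod reg_bimod M) M :=
  @itw_tens reg_bimod M M (fun a m => a ▷ m) (lact_bilin M)
    (fun a b m => lactM a b m) (fun b a m => lactM b a m)
    (fun a m b => esym (lact_ract a m b)) (@bpar_lact _ _ M).

Definition itw_runit : intertwiner (tens_bimod M reg_bimod) M :=
  @itw_tens M reg_bimod M (fun m a => m ◁ a) (ract_bilin M)
    (fun m b a => esym (ractM m b a)) (fun b m a => lact_ract b m a)
    (fun m a b => ractM m a b) (@bpar_ract _ _ M).

Lemma itw_lunitE (a : reg_bimod) m : itw_lunit (tpure a m) = a ▷ m.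
Proof. exact: itw_tensE. Qed.
Lemma itw_runitE m (a : reg_bimod) : itw_runit (tpure m a) = m ◁ a.
Proof. exact: itw_tensE. Qed.

Lemma itw_lunit_iso : @is_iso (bimod_cat A) _ _ itw_lunit.
Proof.
have L : linear (fun m : M => tpure (sone : reg_bimod) m) by lin.
apply: (@intertwiner_iso _ _ _ _ _ (mklin L)) => [|m]; last first.
  by rewrite mklinE itw_lunitE lact1.
apply: tens_bimod_ext; [lin|lin|] => a m.
by rewrite itw_lunitE mklinE -tpure_bal /= smul1.
Qed.

Lemma itw_runit_iso : @is_iso (bimod_cat A) _ _ itw_runit.
Proof.
have L : linear (fun m : M => tpure m (sone : reg_bimod)) by lin.
apply: (@intertwiner_iso _ _ _ _ _ (mklin L)) => [|m]; last first.
  by rewrite mklinE itw_runitE ract1.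
apply: tens_bimod_ext; [lin|lin|] => m a.
by rewrite itw_runitE mklinE tpure_bal /= smulr1.
Qed.

End Unitors.

Section Associator.
Variables M N P : bimod A.

Let inr (p : P) (m : M) (n : N) : tens_bimod M (tens_bimod N P) :=
  tpure m (tpure n p).
Fact inr_bilin p : bilin (inr p).
Proof. by split=> ?; rewrite /inr; lin. Qed.
Fact inr_bal p m a n : inr p (m ◁ a) n = inr p m (a ▷ n).
Proof. by rewrite /inr tpure_bal tpure_lact. Qed.

Let ras (t : tens_bimod M N) (p : P) : tens_bimod M (tens_bimod N P) :=
  tlift (inr p) t.
Fact rasE m n p : ras (tpure m n) p = tpure m (tpure n p).
Proof. exact: tlift_pure (inr_bilin p) (inr_bal p) m n. Qed.
Fact ras_lin p : linear (ras^~ p).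
Proof. by rewrite /ras; lin. Qed.
Fact rasPl p c x y : ras (c *: x + y) p = c *: ras x p + ras y p.
Proof. exact: ras_lin. Qed.
Fact ras1 : bilin ras.
Proof.
split=> [p|+ c x y]; first exact: ras_lin.
apply: tens_bimod_ext => [| |m n].
- exact: ras_lin.
- by apply: linear_comb; apply: ras_lin.
- by rewrite !rasE !tpurePr.
Qed.
Fact ras2 t a p : ras (t ◁ a) p = ras t (a ▷ p).
Proof.
move: t; apply: tens_bimod_ext => [| |m n].
- by move=> c x y; rewrite ractP rasPl.
- exact: ras_lin.
- by rewrite tpure_ract !rasE tpure_bal.
Qed.
Fact ras3 a t p : ras (a ▷ t) p = a ▷ ras t p.
Proof.
move: t; apply: tens_bimod_ext => [| |m n].
- by move=> c x y; rewrite lactP rasPl.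
- by move=> c x y; rewrite rasPl lactP.
- by rewrite tpure_lact !rasE tpure_lact.
Qed.
Fact ras4 t p a : ras t (p ◁ a) = ras t p ◁ a.
Proof.
move: t; apply: tens_bimod_ext => [| |m n].
- exact: ras_lin.
- by move=> c x y; rewrite rasPl ractP.
- by rewrite !rasE !tpure_ract.
Qed.
Fact ras5 i j t p : t \in bpar i -> p \in bpar j -> ras t p \in bpar (i (+) j).
Proof.
move=> ti pj.
have -> : (ras t p \in bpar (i (+) j))
    = (t \in (tlift (inr p) @^-1: bpar (i (+) j))%VS) by rewrite memv_preim.
move: ti; apply: tens_bimod_par_ind => l m n ml nl.
rewrite -memv_preim -/(ras _ _) rasE.
have := tpure_par ml (tpure_par nl pj).
by rewrite -addbA addKb.
Qed.

Definition itw_assoc : intertwiner (tens_bimod (tens_bimod M N) P)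
    (tens_bimod M (tens_bimod N P)) := itw_tens ras1 ras2 ras3 ras4 ras5.
Lemma itw_assocE m n p :
  itw_assoc (tpure (tpure m n) p) = tpure m (tpure n p).
Proof. by rewrite itw_tensE rasE. Qed.

Let inl (m : M) (n : N) (p : P) : tens_bimod (tens_bimod M N) P :=
  tpure (tpure m n) p.
Fact inl_bilin m : bilin (inl m).
Proof. by split=> ?; rewrite /inl; lin. Qed.
Fact inl_bal m n a p : inl m (n ◁ a) p = inl m n (a ▷ p).
Proof. by rewrite /inl -tpure_bal tpure_ract. Qed.
Let las (m : M) (t : tens_bimod N P) : tens_bimod (tens_bimod M N) P :=
  tlift (inl m) t.
Fact lasE m n p : las m (tpure n p) = tpure (tpure m n) p.
Proof. exact: tlift_pure (inl_bilin m) (inl_bal m) n p. Qed.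
Fact las_lin m : linear (las m).
Proof. by rewrite /las; lin. Qed.
Fact lasPr m c x y : las m (c *: x + y) = c *: las m x + las m y.
Proof. exact: las_lin. Qed.
Fact las1 : bilin las.
Proof.
split=> [+ c x y|m]; last exact: las_lin.
apply: tens_bimod_ext => [| |n p].
- exact: las_lin.
- by apply: linear_comb; apply: las_lin.
- by rewrite !lasE !tpurePl.
Qed.
Fact las2 m a t : las (m ◁ a) t = las m (a ▷ t).
Proof.
move: t; apply: tens_bimod_ext => [| |n p].
- exact: las_lin.
- by move=> c x y; rewrite lactP lasPr.
- by rewrite tpure_lact !lasE tpure_bal.
Qed.

Lemma itw_assoc_iso : @is_iso (bimod_cat A) _ _ itw_assoc.
Proof.
have lE := tlift_pure las1 las2.
apply: (@intertwiner_iso _ _ _ _ _ (tlift las)).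
  apply: tens_bimod_ext => [| |t p]; [lin|lin|].
  move: t; apply: tens_bimod_ext => [| |m n]; [lin|lin|].
  by rewrite itw_assocE lE lasE.
apply: tens_bimod_ext => [| |m t]; [lin|lin|].
move: t; apply: tens_bimod_ext => [| |n p]; [lin|lin|].
by rewrite lE lasE itw_assocE.
Qed.

End Associator.

Lemma itw_ext3 (M N P Q : bimod A)
    (f g : intertwiner (tens_bimod (tens_bimod M N) P) Q) :
  (forall m n p, f (tpure (tpure m n) p) = g (tpure (tpure m n) p)) -> f = g.
Proof.
move=> fg; apply: itw_ext => + p.
by apply: tens_bimod_ext => [| |m n]; [lin|lin|].
Qed.

Lemma itw_ext4 (M N P Q S : bimod A)
    (f g : intertwiner (tens_bimod (tens_bimod (tens_bimod M N) P) Q) S) :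
  (forall m n p q, f (tpure (tpure (tpure m n) p) q)
                 = g (tpure (tpure (tpure m n) p) q)) -> f = g.
Proof.
move=> fg; apply: itw_ext3 => + p q.
by apply: tens_bimod_ext => [| |m n]; [lin|lin|].
Qed.

Lemma comp_itwE (M N P : bimod_cat A) (g : mor N P) (f : mor M N) (x : M) :
  itw (g ∘ f)%cat x = itw g (itw f x).
Proof. exact: comp_lfunE. Qed.

Lemma id_itwE (M : bimod_cat A) (x : M) : itw (idm M) x = x.
Proof. exact: id_lfunE. Qed.

Definition End_sAlg : moncat.
Proof.
refine (@MonCat (bimod_cat A) reg_bimod (@tens_bimod k A) itw_tensm
  itw_assoc itw_lunit itw_runit _ _ itw_assoc_iso itw_lunit_iso itw_runit_iso
  _ _ _ _ _).
- by move=> M N; apply: itw_ext => m n; rewrite itw_tensmE !id_itwE.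
- move=> M M' M'' N N' N'' g f g' f'; apply: itw_ext => m n.
  by rewrite comp_itwE !itw_tensmE !comp_itwE.
- move=> M M' N N' P P' f g h; apply: itw_ext3 => m n p.
  by rewrite !comp_itwE !itw_tensmE !itw_assocE !itw_tensmE.
- move=> M N f; apply: itw_ext => a m.
  by rewrite !comp_itwE itw_tensmE !itw_lunitE id_itwE (itw_lact (itwP f)).
- move=> M N f; apply: itw_ext => m a.
  by rewrite !comp_itwE itw_tensmE !itw_runitE id_itwE (itw_ract (itwP f)).
- move=> M N; apply: itw_ext3 => m a n.
  rewrite comp_itwE itw_assocE !itw_tensmE itw_lunitE itw_runitE.
  by rewrite !id_itwE tpure_bal.
- move=> M N P Q; apply: itw_ext4 => m n p q.
  rewrite !comp_itwE !itw_assocE !itw_tensmE !itw_assocE !itw_tensmE.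
  by rewrite !id_itwE !itw_assocE.
Defined.

End EndCategory.

(* The inverse is part of the data, but it is unique and automatically even
   ([evunit_eq], [uinv_even]). *)
Record evunit (k : fieldType) (A : superAlg k) := EvUnit {
  uval :> A;
  uinv : A;
  uval_even : uval \in spar false;
  uvalV : uval · uinv = sone;
  uinvV : uinv · uval = sone
}.

Record aut (k : fieldType) (A : superAlg k) := Aut {
  autf :> 'End(A);
  aut1 : autf sone = sone;
  autM : forall x y, autf (x · y) = autf x · autf y;
  aut_even : forall i x, x \in spar i -> autf x \in spar i;
  aut_bij : bijective autf
}.

Section Aut.
Variables (k : fieldType) (A : superAlg k).
Implicit Types (u v : evunit A) (phi psi chi : aut A).

Lemma uinv_uniq u (b : A) : u · b = sone -> b = uinv u.
Proof. by move=> ub; rewrite -[b]smul1 -(uinvV u) -smulA ub smulr1. Qed.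

Lemma evunit_eq u v : uval u = uval v -> u = v.
Proof.
move=> e; have e' : uinv u = uinv v by apply: uinv_uniq; rewrite -e uvalV.
case: u v e e' => a b ? ? ? [a' b' ? ? ?] /= e e'; subst a' b'.
by congr EvUnit; apply: Prop_irrelevance.
Qed.

Lemma uinv_even u : uinv u \in spar false.
Proof.
have sB := smul_bilin A.
have [w [wP e]] := grading_split (spar_grading A) (uinv u).
have P i : u · w i \in spar i by have := sparM (uval_even u) (wP i).
have Q (i : bool) : (if i then 0 else sone : A) \in spar i.
  by case: i; rewrite ?mem0v ?spar1.
have /= w1 : u · w true = 0.
  apply: (grading_inj (spar_grading A) P Q _ true).
  by rewrite addr0 -(bilinDr sB) -e uvalV.
suff w0 : w true = 0 by rewrite e w0 addr0.
by rewrite -[w true]smul1 -(uinvV u) -smulA w1 (bilin0r sB).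
Qed.

Lemma aut_eq phi psi : autf phi =1 autf psi -> phi = psi.
Proof.
case: phi psi => f ? ? ? ? [g ? ? ? ?] /= /lfunP e; subst g.
by congr Aut; apply: Prop_irrelevance.
Qed.

Definition evunit1 : evunit A :=
  EvUnit (spar1 A) (smul1 sone) (smul1 sone).

Fact evunitM_subproof1 u v : (u : A) · v \in spar false.
Proof. exact: (sparM (uval_even u) (uval_even v)). Qed.
Fact evunitM_subproof2 u v : u · v · (uinv v · uinv u) = sone.
Proof. by rewrite smulA -(smulA u) uvalV smulr1 uvalV. Qed.
Fact evunitM_subproof3 u v : uinv v · uinv u · (u · v) = sone.
Proof. by rewrite smulA -(smulA (uinv v)) uinvV smulr1 uinvV. Qed.
Definition evunitM u v : evunit A :=
  EvUnit (evunitM_subproof1 u v) (evunitM_subproof2 u v)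
    (evunitM_subproof3 u v).

Definition evunitV u : evunit A := EvUnit (uinv_even u) (uinvV u) (uvalV u).

Fact aut_id_subproof : bijective (\1%VF : 'End(A)).
Proof. by exists id => x; rewrite id_lfunE. Qed.
Definition aut_id : aut A.
Proof.
refine (@Aut k A \1%VF _ _ _ aut_id_subproof).
- by rewrite id_lfunE.
- by move=> x y; rewrite !id_lfunE.
- by move=> i x; rewrite id_lfunE.
Defined.

Fact aut_comp_subproof phi psi : bijective (autf phi \o autf psi)%VF.
Proof.
by apply: (eq_bij (bij_comp (aut_bij phi) (aut_bij psi))) => x;
  rewrite comp_lfunE.
Qed.
Definition aut_comp phi psi : aut A.
Proof.
refine (@Aut k A (autf phi \o autf psi)%VF _ _ _ (aut_comp_subproof phi psi)).
- by rewrite comp_lfunE !aut1.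
- by move=> x y; rewrite !comp_lfunE !autM.
- by move=> i x xi; rewrite comp_lfunE; do 2!apply: aut_even.
Defined.

Lemma aut_compE phi psi x : aut_comp phi psi x = phi (psi x).
Proof. exact: comp_lfunE. Qed.
Lemma aut_idE x : aut_id x = x.
Proof. exact: id_lfunE. Qed.

Fact conj_linear u : linear (fun x : A => u · x · uinv u).
Proof.
have sB := smul_bilin A.
by move=> c x y /=; rewrite (bilinr sB) (bilinl sB).
Qed.
Fact inner_bij u : bijective (mklin (conj_linear u)).
Proof.
exists (mklin (conj_linear (evunitV u))) => x; rewrite !mklinE /=.
  by rewrite !smulA uinvV smul1 -smulA uinvV smulr1.
by rewrite !smulA uvalV smul1 -smulA uvalV smulr1.
Qed.

Definition inner u : aut A.
Proof.
refine (@Aut k A (mklin (f := fun x : A => u · x · uinv u) (conj_linear u))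
  _ _ _ (inner_bij u)).
- by rewrite mklinE smulr1 uvalV.
- move=> x y; rewrite !mklinE -!smulA; congr (_ · (_ · _)).
  by rewrite [in RHS]smulA uinvV smul1.
- move=> i x xi; rewrite mklinE -(addbF i) -(addFb i).
  by apply: sparM (uinv_even u); apply: sparM xi; apply: uval_even.
Defined.

Lemma innerE u x : inner u x = u · x · uinv u.
Proof. exact: mklinE. Qed.

Fact aut_act_subproof phi u : phi (uval u) \in spar false.
Proof. exact/aut_even/uval_even. Qed.
Fact aut_act_subproof2 phi u : phi (uval u) · phi (uinv u) = sone.
Proof. by rewrite -autM uvalV aut1. Qed.
Fact aut_act_subproof3 phi u : phi (uinv u) · phi (uval u) = sone.
Proof. by rewrite -autM uinvV aut1. Qed.
Definition aut_act phi u : evunit A :=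
  EvUnit (aut_act_subproof phi u) (aut_act_subproof2 phi u)
    (aut_act_subproof3 phi u).

(* The morphisms of AUT(A)^δ from phi to psi: the pairs (u, phi) whose target
   i(u) ∘ phi is psi; the component phi is recorded by the type. *)
Definition dhom phi psi := {u : evunit A | aut_comp (inner u) phi = psi}.

Lemma dhom_eq phi psi (f g : dhom phi psi) :
  uval (sval f) = uval (sval g) -> f = g.
Proof.
case: f g => u ? [v ?] /= /evunit_eq e; subst v.
by congr exist; apply: Prop_irrelevance.
Qed.

Lemma dhomP phi psi (f : dhom phi psi) x :
  psi x = sval f · phi x · uinv (sval f).
Proof. by case: f => u /= <-; rewrite aut_compE innerE. Qed.

Fact did_subproof phi psi : phi =1 psi -> aut_comp (inner evunit1) phi = psi.
Proof.
by move=> e; apply: aut_eq => x; rewrite aut_compE innerE /= smul1 smulr1 e.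
Qed.
Definition did phi psi (e : phi =1 psi) : dhom phi psi :=
  exist _ evunit1 (did_subproof e).

Fact dcomp_subproof phi psi chi (g : dhom psi chi) (f : dhom phi psi) :
  aut_comp (inner (evunitM (sval g) (sval f))) phi = chi.
Proof.
apply: aut_eq => x.
by rewrite aut_compE innerE (dhomP g) (dhomP f) /= !smulA.
Qed.
Definition dcomp phi psi chi (g : dhom psi chi) (f : dhom phi psi) :
  dhom phi chi := exist _ (evunitM (sval g) (sval f)) (dcomp_subproof g f).

Definition AUT_delta_cat : category.
Proof.
refine (@Category (aut A) dhom (fun phi => did (frefl phi)) dcomp _ _ _).
- by move=> phi psi f; apply: dhom_eq; rewrite /= smul1.
- by move=> phi psi f; apply: dhom_eq; rewrite /= smulr1.
- by move=> phi psi chi xi h g f; apply: dhom_eq; rewrite /= smulA.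
Defined.

Fact dtensm_subproof phi2 psi2 phi1 psi1
    (f2 : dhom phi2 psi2) (f1 : dhom phi1 psi1) :
  aut_comp (inner (evunitM (sval f2) (aut_act phi2 (sval f1))))
    (aut_comp phi2 phi1) = aut_comp psi2 psi1.
Proof.
apply: aut_eq => x.
by rewrite !aut_compE innerE (dhomP f2) (dhomP f1) /= !autM !smulA.
Qed.
Definition dtensm phi2 psi2 phi1 psi1
    (f2 : dhom phi2 psi2) (f1 : dhom phi1 psi1) :
    dhom (aut_comp phi2 phi1) (aut_comp psi2 psi1) :=
  exist _ (evunitM (sval f2) (aut_act phi2 (sval f1)))
    (dtensm_subproof f2 f1).

Fact dassoc_subproof phi psi chi :
  aut_comp (aut_comp phi psi) chi =1 aut_comp phi (aut_comp psi chi).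
Proof. by move=> x; rewrite !aut_compE. Qed.
Fact dlunit_subproof phi : aut_comp aut_id phi =1 phi.
Proof. by move=> x; rewrite aut_compE aut_idE. Qed.
Fact drunit_subproof phi : aut_comp phi aut_id =1 phi.
Proof. by move=> x; rewrite aut_compE aut_idE. Qed.

Lemma did_iso phi psi (e : phi =1 psi) : @is_iso AUT_delta_cat _ _ (did e).
Proof.
by exists (did (fsym e)); split; apply: dhom_eq; rewrite /= smul1.
Qed.

(* The 2-group is strict: its associators and unitors are identities. *)
Definition AUT_delta : moncat.
Proof.
refine (@MonCat AUT_delta_cat aut_id aut_comp dtensm
  (fun phi psi chi => did (dassoc_subproof phi psi chi))
  (fun phi => did (dlunit_subproof phi))
  (fun phi => did (drunit_subproof phi)) _ _ _ _ _ _ _ _ _ _).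
- by move=> phi psi; apply: dhom_eq; rewrite /= aut1 smul1.
- move=> p p' p'' q q' q'' g f g' f'; apply: dhom_eq => /=.
  by rewrite autM (dhomP f) !smulA -(smulA _ (uinv _) (uval _)) uinvV smulr1.
- by move=> *; apply: did_iso.
- by move=> *; apply: did_iso.
- by move=> *; apply: did_iso.
- move=> p p' q q' r r' f g h; apply: dhom_eq => /=.
  by rewrite smul1 smulr1 comp_lfunE autM !smulA.
- by move=> p q f; apply: dhom_eq; rewrite /= !smul1 id_lfunE smulr1.
- by move=> p q f; apply: dhom_eq; rewrite /= smul1 aut1 ?smulr1.
- by move=> p q; apply: dhom_eq; rewrite /= ?lfunE/= ?lfunE/= !aut1 !smul1.
- by move=> p q r s; apply: dhom_eq; rewrite /= ?lfunE/= ?lfunE/= !aut1 !smul1.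
Defined.

Fact twist_ract_bilin phi : bilin (fun x a : A => x · phi a).
Proof.
have sB := smul_bilin A.
split=> [a|x] c y z /=; first by rewrite (bilinl sB).
by rewrite linearP (bilinr sB).
Qed.
Fact twist_ract1 phi (x : A) : x · phi sone = x.
Proof. by rewrite aut1 smulr1. Qed.
Fact twist_ractM phi (x a b : A) : x · phi (a · b) = x · phi a · phi b.
Proof. by rewrite autM smulA. Qed.
Fact twist_par phi i j (x a : A) :
  x \in spar i -> a \in spar j -> x · phi a \in spar (i (+) j).
Proof. by move=> xi aj; apply: sparM xi _; apply: aut_even. Qed.

Definition twist phi : bimod A :=
  @Bimod k A A (@smul k A) (fun x a => x · phi a) (@spar k A) (smul_bilin A)
    (twist_ract_bilin phi) (@smul1 k A) (twist_ract1 phi)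
    (fun a b m => esym (smulA a b m)) (twist_ractM phi)
    (fun a m b => esym (smulA a m (phi b))) (spar_grading A) (@sparM k A)
    (twist_par phi).

Fact twist_mor_linear u : linear (fun x : A => x · uinv u).
Proof. exact: (bilinl (smul_bilin A)). Qed.
Fact twist_mor_subproof phi psi (f : dhom phi psi) :
  is_intertwiner
    (mklin (twist_mor_linear (sval f)) : 'Hom(twist phi, twist psi)).
Proof.
split=> [a x|x a|i x xi]; rewrite !mklinE /=.
- by rewrite smulA.
- rewrite (dhomP f) -!smulA; congr (_ · _).
  by rewrite !smulA uinvV smul1.
- by rewrite -(addbF i); apply: sparM xi (uinv_even _).
Qed.
Definition twist_mor phi psi (f : dhom phi psi) :
    intertwiner (twist phi) (twist psi) :=
  @Intertwiner k A (twist phi) (twist psi)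
    (mklin (f := fun x : A => x · uinv (sval f)) (twist_mor_linear (sval f)))
    (twist_mor_subproof f).

Lemma twist_morE phi psi (f : dhom phi psi) (x : twist phi) :
  twist_mor f x = (x : A) · uinv (sval f).
Proof. exact: mklinE. Qed.

Definition twist_functor : functor AUT_delta (End_sAlg A).
Proof.
refine (@Functor AUT_delta (End_sAlg A) twist twist_mor _ _).
- move=> phi; apply: intertwiner_eq => x.
  by rewrite twist_morE id_itwE /= smulr1.
- move=> phi psi chi g f; apply: intertwiner_eq => x.
  by rewrite comp_itwE !twist_morE /= smulA.
Defined.

Fact twist_unit_subproof :
  is_intertwiner (\1%VF : 'Hom(reg_bimod A, twist aut_id)).
Proof.
by split=> [a x|x a|i x xi]; rewrite !id_lfunE //= id_lfunE.
Qed.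
Definition twist_unit : intertwiner (reg_bimod A) (twist aut_id) :=
  Intertwiner twist_unit_subproof.

Fact twist_mul_bal phi psi (x a y : A) : x · phi a · phi y = x · phi (a · y).
Proof. by rewrite autM smulA. Qed.
Fact twist_mul_ract phi psi (x y a : A) :
  x · phi (y · psi a) = x · phi y · aut_comp phi psi a.
Proof. by rewrite autM smulA aut_compE. Qed.

Definition twist_mul phi psi :
    intertwiner (tens_bimod (twist phi) (twist psi)) (twist (aut_comp phi psi)) :=
  @itw_tens k A (twist phi) (twist psi) (twist (aut_comp phi psi))
    (fun x y => (x : A) · phi y) (twist_ract_bilin phi) (twist_mul_bal phi psi)
    (fun a x y => esym (smulA a x (phi y))) (twist_mul_ract phi psi)
    (twist_par phi).

Lemma twist_mulE phi psi (x : twist phi) (y : twist psi) :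
  twist_mul phi psi (tpure x y) = (x : A) · phi y.
Proof. exact: itw_tensE. Qed.

Lemma twist_unit_iso : @is_iso (bimod_cat A) _ _ twist_unit.
Proof.
by apply: (@intertwiner_iso _ _ _ _ twist_unit \1%VF) => x;
  rewrite /= !id_lfunE.
Qed.

Lemma twist_mul_iso phi psi : @is_iso (bimod_cat A) _ _ (twist_mul phi psi).
Proof.
have L : linear (fun x : twist (aut_comp phi psi) =>
    tpure (x : twist phi) (sone : twist psi)).
  by move=> c x y; apply: tpurePl.
apply: (@intertwiner_iso _ _ _ _ _ (mklin L)) => [|x]; last first.
  by rewrite mklinE twist_mulE aut1 smulr1.
apply: tens_bimod_ext; [lin|lin|] => x y.
rewrite twist_mulE mklinE.
by rewrite (tpure_bal (x : twist phi) y (sone : twist psi)) /= smulr1.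
Qed.

Definition twist_monfun : monfun AUT_delta (End_sAlg A).
Proof.
refine (@MonFun AUT_delta (End_sAlg A) twist_functor twist_unit twist_mul
  twist_unit_iso twist_mul_iso _ _ _ _).
- move=> p p' q q' f g; apply: itw_ext => x y.
  rewrite !comp_itwE itw_tensmE !twist_mulE !twist_morE /=.
  rewrite (dhomP f) !autM -!smulA; congr (_ · _).
  by rewrite !smulA uinvV smul1.
- move=> p q r; apply: itw_ext3 => x y z.
  rewrite !comp_itwE itw_assocE !itw_tensmE !twist_mulE !twist_morE /=.
  by rewrite !id_lfunE smulr1 comp_lfunE autM smulA.
- move=> p; apply: itw_ext => x y.
  rewrite [RHS]itw_lunitE !comp_itwE itw_tensmE twist_mulE twist_morE /=.
  by rewrite !id_lfunE smulr1.
- move=> p; apply: itw_ext => x y.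
  rewrite [RHS]itw_runitE !comp_itwE itw_tensmE twist_mulE twist_morE /=.
  by rewrite !id_lfunE smulr1.
Defined.

Definition AUT_sAlg : moncat := pic (End_sAlg A).

Definition picard_surjective : Prop :=
  forall M : End_sAlg A, weakly_invertible M ->
    exists phi : aut A, @isomorphic (End_sAlg A) M (twist phi).

End Aut.

Inductive ground := GroundReal | GroundComplex.

Definition ground_field (R : realType) (c : ground) : fieldType :=
  match c with GroundReal => R | GroundComplex => R[i] end.

(* Main.v *)
Require Import Defs.
From mathcomp Require Import all_boot all_order all_algebra.
From mathcomp Require Import reals.
From mathcomp Require Import boolp.

(** The functor lands in the Picard 2-group because monoidal functors preserve
    isomorphisms and weakly invertible objects, and every object of
    AUT(A)^δ is strictly invertible.  By the classical criterion
    ([fully_faithful_ess_surj_equivalence]), a monoidal functor that is full,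
    faithful and essentially surjective is a monoidal equivalence, so three
    things remain.

    Essential surjectivity is Picard-surjectivity.

    Faithfulness ([twist_mor_inj]): the intertwiner of (a, φ) sends 1 to
    a^{-1}, which determines a.

    Fullness ([twist_mor_surj]): an invertible intertwiner f from A_φ to A_ψ
    is left A-linear, hence is right multiplication by b = f(1).  The inverse
    of f is right multiplication by some a in the same way, so b = a^{-1}, and
    both are even because 1 is.  Evaluating right linearity of f at 1 gives
    φ(x) b = b ψ(x), that is ψ = i(a) ∘ φ, so f is the image of (a, φ).

    The criterion itself is proved by choosing, for each Y, an object G Y and
    an isomorphism ε_Y from F (G Y) to Y.  Full faithfulness then says that
    ε_Y ∘ F is a bijection from morphisms X -> G Y to morphisms F X -> Y
    ([transpose], [transpose_inj]), so that every piece of structure on G is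
    the transpose of the evident map in D and every law for G may be checked
    after applying ε ∘ F. *)

Set Implicit Arguments.
Unset Strict Implicit.
Unset Printing Implicit Defensive.

(** * Isomorphisms and weakly invertible objects *)

Lemma iso_monic (C : category) (X Y Z : C) (f : mor Y Z) (g h : mor X Y) :
  is_iso f -> f ∘ g = f ∘ h -> g = h.
Proof.
by move=> [f' [f'f _]] e; rewrite -[g]comp1m -[h]comp1m -f'f -!compmA e.
Qed.

Lemma iso_epic (C : category) (X Y Z : C) (f : mor X Y) (g h : mor Y Z) :
  is_iso f -> g ∘ f = h ∘ f -> g = h.
Proof.
by move=> [f' [_ ff']] e; rewrite -[g]compm1 -[h]compm1 -ff' !compmA e.
Qed.

Section InverseMorphism.
Variables (C : category) (X Y : C) (f : mor X Y) (f_iso : is_iso f).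

Definition inv_mor : mor Y X := sval (cid f_iso).

Lemma inv_morK : inv_mor ∘ f = idm X.
Proof. by rewrite /inv_mor; case: cid => g []. Qed.

Lemma inv_morVK : f ∘ inv_mor = idm Y.
Proof. by rewrite /inv_mor; case: cid => g []. Qed.

Lemma inv_mor_iso : is_iso inv_mor.
Proof. by exists f; rewrite inv_morK inv_morVK. Qed.

End InverseMorphism.

(** F carries an isomorphism Z ⊗ T -> 1 to F Z ⊗ F T ≅ F (Z ⊗ T) ≅ F 1 ≅ 1. *)
Lemma weakly_invertible_monfun (C D : moncat) (F : monfun C D) (X : C) :
  weakly_invertible X -> weakly_invertible (F X).
Proof.
have FM (Z T : C) : isomorphic (Z ⊗ T) tunit -> isomorphic (F Z ⊗ F T) tunit.
  move=> [f f_iso]; exists (inv_mor (munit_iso F) ∘ fhom F f ∘ mmul F Z T).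
  apply: iso_comp (mmul_iso F Z T).
  exact: iso_comp (inv_mor_iso _) (fhom_iso F f_iso).
by move=> [Y [XY YX]]; exists (F Y); split; apply: FM.
Qed.

Lemma lands_in_pic_2group (C D : moncat) (F : monfun C D) :
  is_2group C -> lands_in_pic F.
Proof.
move=> [C_iso C_inv]; split=> [X|X Y f].
  exact: weakly_invertible_monfun.
exact: fhom_iso.
Qed.

Lemma pic_is_2group (C : moncat) : is_2group (pic C).
Proof.
split=> [X Y f|[X X_inv]]; first exact: pic_iso.
have [Y [XY YX]] := X_inv; have Y_inv : weakly_invertible Y by exists X.
have pic_isomorphic (Z T : pic C) :
    isomorphic (sval Z) (sval T) -> isomorphic Z T.
  by move=> [f f_iso]; exists (exist _ f f_iso); apply: pic_iso.
by exists (exist _ Y Y_inv); split; apply: pic_isomorphic.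
Qed.

(** * Full, faithful, essentially surjective monoidal functors *)

Definition full (C D : category) (F : functor C D) : Prop :=
  forall (X Y : C) (h : mor (F X) (F Y)), exists f : mor X Y, fhom F f = h.

Definition faithful (C D : category) (F : functor C D) : Prop :=
  forall X Y : C, injective (@fhom C D F X Y).

Definition essentially_surjective (C D : category) (F : functor C D) : Prop :=
  forall Y : D, exists X : C, isomorphic (F X) Y.

Lemma fully_faithful_reflects_iso (C D : category) (F : functor C D)
    (X Y : C) (f : mor X Y) :
  full F -> faithful F -> is_iso (fhom F f) -> is_iso f.
Proof.
move=> F_full F_faithful [h [hf fh]]; have [g gh] := F_full _ _ h.
by exists g; split; apply: F_faithful; rewrite fhom_comp fhom_id gh.
Qed.

Section MonoidalInverse.
Variables (C D : moncat) (F : monfun C D).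
Hypotheses (F_full : full F) (F_faithful : faithful F).
Variables (G : D -> C) (eps : forall Y, mor (F (G Y)) Y).
Hypothesis eps_iso : forall Y, is_iso (eps Y).

Fact transpose_subproof (X : C) (Y : D) (h : mor (F X) Y) :
  exists g : mor X (G Y), eps Y ∘ fhom F g = h.
Proof.
have [g gE] := F_full (inv_mor (eps_iso Y) ∘ h).
by exists g; rewrite gE compmA inv_morVK comp1m.
Qed.

(** G is right adjoint to F with counit eps, and this is the adjunction
    bijection; being unique ([transpose_inj]), a transpose may be picked by
    choice without losing functoriality. *)
Definition transpose (X : C) (Y : D) (h : mor (F X) Y) : mor X (G Y) :=
  sval (cid (transpose_subproof h)).

Lemma transposeE (X : C) (Y : D) (h : mor (F X) Y) :
  eps Y ∘ fhom F (transpose h) = h.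
Proof. by rewrite /transpose; case: cid. Qed.

Lemma transpose_inj (X : C) (Y : D) (g g' : mor X (G Y)) :
  eps Y ∘ fhom F g = eps Y ∘ fhom F g' -> g = g'.
Proof. by move=> /(iso_monic (eps_iso Y))/F_faithful. Qed.

Lemma transpose_iso (X : C) (Y : D) (h : mor (F X) Y) :
  is_iso h -> is_iso (transpose h).
Proof.
move=> h_iso; apply: fully_faithful_reflects_iso => //.
suff -> : fhom F (transpose h) = inv_mor (eps_iso Y) ∘ h.
  by apply: iso_comp => //; apply: inv_mor_iso.
by apply: (iso_monic (eps_iso Y)); rewrite transposeE compmA inv_morVK comp1m.
Qed.

Definition inverse_hom (Y Y' : D) (f : mor Y Y') : mor (G Y) (G Y') :=
  transpose (f ∘ eps Y).

Definition inverse_functor : functor D C.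
Proof.
refine (@Functor D C G inverse_hom _ _).
- by move=> Y; apply: transpose_inj; rewrite transposeE comp1m fhom_id compm1.
- move=> X Y Z g f; apply: transpose_inj.
  by rewrite transposeE fhom_comp compmA transposeE -!compmA transposeE.
Defined.

Definition inverse_munit : mor tunit (G tunit) :=
  transpose (inv_mor (munit_iso F)).

Definition inverse_mmul (X Y : D) : mor (G X ⊗ G Y) (G (X ⊗ Y)) :=
  transpose ((eps X ⊗m eps Y) ∘ inv_mor (mmul_iso F (G X) (G Y))).

Lemma eps_munit : eps tunit ∘ (fhom F inverse_munit ∘ munit F) = idm tunit.
Proof. by rewrite compmA transposeE inv_morK. Qed.

Lemma eps_mmul (X Y : D) :
  eps (X ⊗ Y) ∘ (fhom F (inverse_mmul X Y) ∘ mmul F (G X) (G Y))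
    = eps X ⊗m eps Y.
Proof. by rewrite compmA transposeE -compmA inv_morK compm1. Qed.

(** The form in which [eps_mmul] is met in the laws for the inverse: the
    structure map of the inverse preceded by a tensor product in the source. *)
Lemma eps_mmul_tensm (X Y : D) (Z T : C) (f : mor Z (G X)) (g : mor T (G Y)) :
  eps (X ⊗ Y) ∘ fhom F (inverse_mmul X Y) ∘ fhom F (f ⊗m g) ∘ mmul F Z T
    = (eps X ∘ fhom F f) ⊗m (eps Y ∘ fhom F g).
Proof.
by rewrite -compmA -mmul_nat !compmA -(compmA (eps _)) eps_mmul tensm_comp.
Qed.

(** Each law is transposed to an equation in D and precomposed with structure
    isomorphisms of F; the structure maps of G then collapse by [transposeE]
    and [eps_mmul_tensm], leaving functoriality of the tensor product of D or
    naturality of its associator or unitors. *)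
Definition inverse_monfun : monfun D C.
Proof.
refine (@MonFun D C inverse_functor inverse_munit inverse_mmul _ _ _ _ _ _).
- by apply: transpose_iso; apply: inv_mor_iso.
- move=> X Y; apply: transpose_iso.
  by apply: iso_comp (inv_mor_iso _); apply: iso_tensm.
- move=> X X' Y Y' f g; apply: transpose_inj.
  apply: (iso_epic (mmul_iso F _ _)).
  rewrite !fhom_comp !compmA eps_mmul_tensm !transposeE.
  by rewrite -!compmA eps_mmul tensm_comp.
- move=> X Y Z; apply: transpose_inj.
  apply: (iso_epic (mmul_iso F _ _)).
  apply: (iso_epic (iso_tensm (mmul_iso F _ _) (iso_id _))).
  (* Both sides reduce to the associator following or preceding a triple
     tensor product of the counits. *)
  transitivity (assoc X Y Z ∘ ((eps X ⊗m eps Y) ⊗m eps Z)).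
    rewrite !fhom_comp !compmA transposeE.
    rewrite -!compmA; congr (_ ∘ _).
    rewrite !compmA eps_mmul_tensm -tensm_comp.
    by rewrite fhom_id !compm1 -compmA eps_mmul.
  rewrite assoc_nat !fhom_comp.
  rewrite -!compmA (compmA (fhom F (assoc _ _ _))) mmul_assoc.
  rewrite !compmA eps_mmul_tensm -tensm_comp.
  by rewrite fhom_id !compm1 -compmA eps_mmul.
- move=> X; apply: transpose_inj.
  apply: (iso_epic (mmul_iso F _ _)).
  apply: (iso_epic (iso_tensm (munit_iso F) (iso_id _))).
  rewrite -[RHS]compmA -[RHS]compmA (compmA (fhom F _)) mmul_lunit.
  rewrite !fhom_comp !compmA transposeE -[LHS]compmA.
  rewrite -lunit_nat -!compmA; congr (_ ∘ _).
  rewrite !compmA eps_mmul_tensm -tensm_comp.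
  by rewrite fhom_id !compm1 -compmA eps_munit.
- move=> X; apply: transpose_inj.
  apply: (iso_epic (mmul_iso F _ _)).
  apply: (iso_epic (iso_tensm (iso_id _) (munit_iso F))).
  rewrite -[RHS]compmA -[RHS]compmA (compmA (fhom F _)) mmul_runit.
  rewrite !fhom_comp !compmA transposeE -[LHS]compmA.
  rewrite -runit_nat -!compmA; congr (_ ∘ _).
  rewrite !compmA eps_mmul_tensm -tensm_comp.
  by rewrite fhom_id !compm1 -compmA eps_munit.
Defined.

Lemma inverse_counit_natiso :
  monoidally_isomorphic (comp_monfun F inverse_monfun) (id_monfun D).
Proof.
exists eps; split=> //=.
- by move=> X Y f; rewrite transposeE.
- exact: eps_munit.
- by move=> X Y; rewrite comp1m eps_mmul.
Qed.

Lemma inverse_unit_natiso :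
  monoidally_isomorphic (id_monfun C) (comp_monfun inverse_monfun F).
Proof.
exists (fun X => transpose (idm (F X))); split=> /=.
- by move=> X; apply: transpose_iso; apply: iso_id.
- move=> X Y f; apply: transpose_inj.
  rewrite !fhom_comp !compmA !transposeE comp1m -compmA transposeE.
  by rewrite compm1.
- apply: transpose_inj.
  rewrite compm1 transposeE fhom_comp compmA transposeE -compmA transposeE.
  by rewrite inv_morVK.
- move=> X Y; apply: transpose_inj.
  apply: (iso_epic (mmul_iso F _ _)).
  rewrite compm1 transposeE comp1m !fhom_comp.
  rewrite !compmA transposeE -!compmA (compmA (eps _)) (compmA (eps _ ∘ _)).
  by rewrite eps_mmul_tensm !transposeE tensm_id compm1.
Qed.

End MonoidalInverse.

Theorem fully_faithful_ess_surj_equivalence (C D : moncat) (F : monfun C D) :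
  full F -> faithful F -> essentially_surjective F -> is_monoidal_equivalence F.
Proof.
move=> F_full F_faithful F_surj.
pose G Y := sval (cid (F_surj Y)); pose e Y := cid (svalP (cid (F_surj Y))).
pose eps Y : mor (F (G Y)) Y := sval (e Y).
have eps_iso Y : is_iso (eps Y) := svalP (e Y).
exists (inverse_monfun F_full F_faithful eps_iso); split.
  exact: inverse_unit_natiso.
exact: inverse_counit_natiso.
Qed.

(** * The crossed module of a super algebra *)

Import GRing.Theory.
Local Open Scope ring_scope.

Section CrossedModule.
Variables (k : fieldType) (A : superAlg k).
Implicit Types phi psi : aut A.

Lemma aut_inverse phi : exists psi : aut A, cancel phi psi /\ cancel psi phi.
Proof.
have [g phiK gK] := aut_bij phi.
have g_lin : linear g.
  by move=> c x y; apply: (can_inj phiK); rewrite linearP /= !gK.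
have gE := mklinE g_lin.
(* As phi is even, it maps the homogeneous components of g x to those of x;
   so the component of g x in degree i is all of it. *)
have g_even i x : x \in spar i -> mklin g_lin x \in spar i.
  move=> xi; rewrite gE.
  have [u [uP e]] := grading_split (spar_grading A) (g x).
  have w_even j : (if j == i then x else 0) \in @spar _ A j.
    by case: eqP => [->//|_]; rewrite mem0v.
  have phiu j : phi (u j) = if j == i then x else 0.
    apply: (grading_inj (spar_grading A) (fun j => aut_even phi (uP j)) w_even).
    by rewrite -linearD -e /= gK; case: (i); rewrite /= ?addr0 ?add0r.
  have <- : u i = g x by apply: (can_inj phiK); rewrite phiu eqxx gK.
  exact: uP.
have g1 : mklin g_lin sone = sone by rewrite gE -{1}(aut1 phi) phiK.
have gM x y : mklin g_lin (x · y) = mklin g_lin x · mklin g_lin y.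
  by rewrite !gE; apply: (can_inj phiK); rewrite autM !gK.
have g_bij : bijective (mklin g_lin).
  by exists phi => x; rewrite gE.
by exists (Aut g1 gM g_even g_bij); split=> x; rewrite /= gE.
Qed.

Lemma AUT_delta_is_2group : is_2group (AUT_delta A).
Proof.
split=> [phi psi f|phi].
  have fV : aut_comp (inner (evunitV (sval f))) psi = phi.
    apply: aut_eq => x; rewrite aut_compE innerE (dhomP f) /=.
    by rewrite -!smulA uinvV smulr1 smulA uinvV smul1.
  exists (exist _ (evunitV (sval f)) fV).
  by split; apply: dhom_eq; rewrite /= ?uinvV ?uvalV.
have [psi [phiK psiK]] := aut_inverse phi.
have phipsi : aut_comp phi psi =1 aut_id A.
  by move=> x; rewrite aut_compE aut_idE psiK.
have psiphi : aut_comp psi phi =1 aut_id A.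
  by move=> x; rewrite aut_compE aut_idE phiK.
exists psi; split.
  by exists (did phipsi); apply: did_iso.
by exists (did psiphi); apply: did_iso.
Qed.

Lemma twist_mor_inj phi psi : injective (@twist_mor k A phi psi).
Proof.
move=> f g fg; apply: dhom_eq.
have vE (h : dhom phi psi) : uinv (sval h) = twist_mor h (sone : A).
  by rewrite twist_morE smul1.
have e : evunitV (sval f) = evunitV (sval g).
  by apply: evunit_eq; rewrite /= !vE fg.
exact: (congr1 (@uinv k A) e).
Qed.

(** A_φ is free of rank one as a left module, so left linearity alone makes f
    a right multiplication. *)
Lemma intertwiner_twistE phi psi (f : intertwiner (twist phi) (twist psi))
    (x : A) : f x = x · (f (sone : A) : A).
Proof. by rewrite -[in LHS](smulr1 x); apply: (itw_lact (itwP f)). Qed.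

(** Invertibility of f is what makes f(1) a unit; the unit wanted is the value
    at 1 of the inverse of f, since u acts by right multiplication with
    u^{-1}. *)
Lemma twist_mor_surj phi psi (f : intertwiner (twist phi) (twist psi)) :
  @is_iso (bimod_cat A) _ _ f -> exists u : dhom phi psi, twist_mor u = f.
Proof.
move=> [g [gf fg]]; pose b : A := f (sone : A); pose a : A := g (sone : A).
have ab : a · b = sone.
  by rewrite -(intertwiner_twistE f) -comp_itwE fg id_itwE.
have ba : b · a = sone.
  by rewrite -(intertwiner_twistE g) -comp_itwE gf id_itwE.
have a_even : a \in spar false := itw_even (itwP g) (spar1 A).
pose u := EvUnit a_even ab ba.
have b_twist x : phi x · b = b · psi x.
  rewrite -(intertwiner_twistE f) -[phi x]smul1.
  exact: (itw_ract (itwP f) (sone : twist phi) x).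
have u_target : aut_comp (inner u) phi = psi.
  apply: aut_eq => x.
  by rewrite aut_compE innerE /= -smulA b_twist smulA ab smul1.
exists (exist _ u u_target); apply: intertwiner_eq => x.
by rewrite twist_morE intertwiner_twistE.
Qed.

End CrossedModule.

Theorem proposition2p3p1 (R : realType) (c : ground)
    (A : superAlg (ground_field R c)) (A_picard : picard_surjective A) :
  exists landsA : lands_in_pic (twist_monfun A),
    is_2group_equivalence
      (corestr landsA : monfun (AUT_delta A) (AUT_sAlg A)).
Proof.
have AUT_2group := AUT_delta_is_2group A.
exists (lands_in_pic_2group (twist_monfun A) AUT_2group).
split=> //; first exact: pic_is_2group.
apply: fully_faithful_ess_surj_equivalence.
- move=> phi psi [f f_iso]; have [u uf] := twist_mor_surj f_iso.
  by exists u; apply: pic_hom_eq.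
- by move=> phi psi u v /(congr1 sval)/twist_mor_inj.
- move=> [M M_inv]; have [phi M_phi] := A_picard M M_inv.
  have [f f_iso] := isomorphic_sym M_phi.
  by exists phi, (exist _ f f_iso); apply: pic_iso.
Qed.
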